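(* On the Lie supergroup $\mathbb T=\mathrm{sMink}(d,1|D_{d,1})$ let $\mathrm H_{\rm GS}\in\Omega^3(\mathbb T)$, $\varrho_{\rm GS}\in\Omega^2(\mathbb T^{\times2})$, $\vartheta_{\rm GS}\in\Omega^1(\mathbb T^{\times 3})$ be given, for $m_A=(\theta_A,x_A)$, by $$\mathrm H_{\rm GS}=\sigma_{\rm L}\wedge\bar\Gamma_a\sigma_{\rm L}\wedge e_{\rm L}^a,$$ $$\varrho_{\rm GS}(m_1,m_2)=-2\eta_{ab}\,e_{\rm L}^a(m_1)\wedge e_{\rm R}^b(m_2)-2\,\theta_2\bar\Gamma_a\sigma_{\rm L}(m_1)\wedge\big(e_{\rm L}^a(m_1)+dx_2^a-\tfrac16\theta_2\bar\Gamma^ad\theta_2\big),$$ $$\vartheta_{\rm GS}(m_1,m_2,m_3)=-\tfrac23\,\theta_2\bar\Gamma_a\theta_3\,\big(3e_{\rm L}^a(m_1)+2\theta_2\bar\Gamma^a\sigma_{\rm L}(m_1)+\theta_3\bar\Gamma^a\sigma_{\rm L}(m_1)\big).$$ Then the quintuple $\mathcal Z_{\rm GS}=(0,\mathrm H_{\rm GS},\varrho_{\rm GS},\vartheta_{\rm GS},0)$ is a simplicial de Rham 4-cocycle over the nerve $\mathsf N_\bullet\mathbb T^{\rm op}$, i.e. $$\mathrm d\mathrm H_{\rm GS}=0,\qquad \Delta_{\mathbb T}\mathrm H_{\rm GS}=\mathrm d\varrho_{\rm GS},\qquad \Delta_{\mathbb T}\varrho_{\rm GS}=\mathrm d\vartheta_{\rm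 GS},\qquad \Delta_{\mathbb T}\vartheta_{\rm GS}=0.$$
   Context: $\mathbb T=\mathrm{sMink}(d,1|D_{d,1})$ is the supermanifold $\mathbb R^{d,1|D_{d,1}}$ with global even coordinates $x^a$ ($a=0,\dots,d$) and odd coordinates $\theta^\alpha$ ($\alpha=1,\dots,D_{d,1}$), the latter in a Majorana-spinor representation of $\mathrm{Spin}(d,1)$ inside the Clifford algebra $\{\Gamma_a,\Gamma_b\}=2\eta_{ab}\mathbf 1$, $\eta=\mathrm{diag}(-,+,\dots,+)$. $C$ is a skew charge-conjugation matrix, $\bar\Gamma_a=C\Gamma_a$, indices are raised with $\eta^{-1}$, and it is assumed that $\bar\Gamma_a^{\rm T}=\bar\Gamma_a$ and that the Fierz identity $\eta_{ab}\bar\Gamma^a_{\alpha(\beta}\bar\Gamma^b_{\gamma\delta)}=0$ holds. Notation: $\theta\bar\Gamma^a\theta'=\theta^\alpha\bar\Gamma^a_{\alpha\beta}\theta'^\beta$. The group law is $$(\theta_1,x_1)\cdot(\theta_2,x_2)=(\theta_1+\theta_2,\ x_1^a+x_2^a-\tfrac12\theta_1\bar\Gamma^a\theta_2).$$ Left-invariant forms: $\sigma_{\rm L}^\alpha=d\theta^\alpha$, $e_{\rm L}^a=dx^a+\tfrac12\theta\bar\Gamma^ad\theta$; right-invariant: $e_{\rm R}^a=dx^a-\tfrac12\theta\bar\Gamma^ad\theta$. Superforms obey the bigraded sign rule $\alpha\wedge\beta=(-1)^{pq+|\alpha||\beta|}\beta\wedge\alpha$ ($p,q$ form degrees, $|\cdot|$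 Grassmann parities). $\mathsf N_n\mathbb T^{\rm op}=\mathbb T^{\times n}$ with face maps $d_0(m_1,\dots,m_n)=(m_2,\dots,m_n)$, $d_i(m_1,\dots,m_n)=(m_1,\dots,m_i\cdot m_{i+1},\dots,m_n)$ for $0<i<n$, $d_n(m_1,\dots,m_n)=(m_1,\dots,m_{n-1})$, and $\Delta_{\mathbb T}=\sum_{i=0}^{n+1}(-1)^id_i^*:\Omega^p(\mathbb T^{\times n})\to\Omega^p(\mathbb T^{\times n+1})$. *)

(* Defs.v *)
From HB Require Import structures.
From mathcomp Require Import all_boot all_order all_fingroup all_algebra.
From mathcomp Require Import all_classical all_reals all_analysis.

Set Implicit Arguments.
Unset Strict Implicit.
Unset Printing Implicit Defensive.

Import Order.TTheory GRing.Theory Num.Theory.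
Import numFieldNormedType.Exports.

Local Open Scope ring_scope.

(** * Spinor data *)

Section SpinorData.
Variables (R : realType) (d D : nat).

Definition eta : 'M[R]_d.+1 :=
  \matrix_(a, b) (if a == b then (if a == ord0 then -1 else 1) else 0).

Variables (Gam : 'I_d.+1 -> 'M[R]_D) (C : 'M[R]_D).

Definition Gbar (a : 'I_d.+1) : 'M[R]_D := C *m Gam a.

Definition GbarU (a : 'I_d.+1) : 'M[R]_D :=
  \sum_b invmx eta a b *: Gbar b.

(* Majorana spinors have real components, so the gamma matrices and the
   charge-conjugation matrix are real.  The relation C Gam_a C^-1 = - Gam_a^T
   is a consequence of [maj_skew], [maj_unit] and [maj_sym]. *)
Record majorana : Prop := Majorana {
  maj_clifford : forall a b,
    Gam a *m Gam b + Gam b *m Gam a = (2 * eta a b)%:M;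
  maj_unit : C \in unitmx;
  maj_skew : C^T = - C;
  maj_sym : forall a, (Gbar a)^T = Gbar a
}.

(* Symmetrisation, with weight 1/3!, over the last three spinor indices. *)
Definition fierz : Prop :=
  forall (al : 'I_D) (i : 'I_3 -> 'I_D),
    3`!%:R^-1 * (\sum_(s : 'S_3) \sum_a \sum_b
      eta a b * GbarU a al (i (s (inord 0)))
              * GbarU b (i (s (inord 1))) (i (s (inord 2)))) = 0.

End SpinorData.

(** * Superforms on the n-fold product of sMink(d,1|D) *)

Section Superforms.
Variables (R : realType) (d D : nat).

(* The underlying manifold of the n-fold product; row A holds x_A. *)
Definition body (n : nat) := 'M[R]_(n, d.+1).

(* Generators of the algebra of superforms over the functions on the body:
   inl (inl (A, al)) is theta_A^al, inl (inr (A, a)) is dx_A^a and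
   inr (A, al) is dtheta_A^al. *)
Definition generator (n : nat) : finType :=
  (('I_n * 'I_D) + ('I_n * 'I_d.+1) + ('I_n * 'I_D))%type.

Definition gth n (A : 'I_n) (al : 'I_D) : generator n := inl (inl (A, al)).
Definition gdx n (A : 'I_n) (a : 'I_d.+1) : generator n := inl (inr (A, a)).
Definition gdth n (A : 'I_n) (al : 'I_D) : generator n := inr (A, al).

Definition gen_deg n (g : generator n) : nat :=
  match g with inl (inl _) => 0 | inl (inr _) => 1 | inr _ => 1 end.

Definition gen_par n (g : generator n) : nat :=
  match g with inl (inl _) => 1 | inl (inr _) => 0 | inr _ => 1 end.

(* g /\ h = (-1)^(swap g h) h /\ g *)
Definition swap n (g h : generator n) : nat :=
  (gen_deg g * gen_deg h + gen_par g * gen_par h)%N.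

(* Exponent vectors; the monomial of m is the product of the g ^ (m g), taken
   in the order of [enum (generator n)]. *)
Definition monomial (n : nat) := {ffun generator n -> nat}.

Definition mon1 n : monomial n := [ffun => 0%N].
Definition mon_gen n (g : generator n) : monomial n := [ffun h => (h == g) : nat].
Definition mon_mul n (m1 m2 : monomial n) : monomial n :=
  [ffun g => (m1 g + m2 g)%N].
Definition mon_div n (m m1 : monomial n) : monomial n :=
  [ffun g => (m g - m1 g)%N].
Definition mon_bounded n b (k : {ffun generator n -> 'I_b}) : monomial n :=
  [ffun g => val (k g)].

Definition mon_deg n (m : monomial n) : nat := (\sum_g m g * gen_deg g)%N.

(* g /\ g = - g /\ g forces the square of theta and of dx to vanish. *)
Definition mon_valid n (m : monomial n) : bool :=
  [forall g, odd (swap g g) ==> (m g <= 1)%N].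

(* Sign produced by reordering the juxtaposition of m1 and m2 : each generator
   of m1 is moved past the smaller generators of m2. *)
Definition mon_sign n (m1 m2 : monomial n) : R :=
  (-1) ^+ (\sum_g \sum_(h | (enum_rank h < enum_rank g)%N)
             m1 g * m2 h * swap g h)%N.

(* Families of coefficients indexed by monomials.  The superforms of form
   degree p are carved out by [superform p] below; the operations are defined
   on all families. *)
Definition sform (n : nat) := monomial n -> body n -> R^o.

Definition pdiff n (i : 'I_n * 'I_d.+1) (f : body n -> R^o) : body n -> R^o :=
  fun y => 'D_(delta_mx i.1 i.2) f y.

Definition smooth n (f : body n -> R^o) : Prop :=
  forall (s : seq ('I_n * 'I_d.+1)) (y : body n),
    differentiable (foldr (@pdiff n) f s) y.

Definition superform p n (w : sform n) : Prop :=
  (forall m, smooth (w m)) /\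
  (forall m, ~~ (mon_valid m && (mon_deg m == p)) -> w m = 0).

Definition fform n (f : body n -> R^o) : sform n :=
  fun m y => if m == mon1 n then f y else 0.

Definition form1 n : sform n := fform (fun=> 1).

Definition gform n (g : generator n) : sform n :=
  fun m _ => if m == mon_gen g then 1 else 0.

Definition wedge n (u v : sform n) : sform n := fun m y =>
  if mon_valid m then
    \sum_(k : {ffun generator n -> 'I_(\sum_g m g).+1} |
            [forall g, (k g <= m g)%N])
      mon_sign (mon_bounded k) (mon_div m (mon_bounded k)) *
      (u (mon_bounded k) y * v (mon_div m (mon_bounded k)) y)
  else 0.

Definition wpow n (u : sform n) (k : nat) : sform n :=
  iter k (wedge u) (@form1 n).

(* Left derivative along theta_A^al :
   theta /\ (monomial of m) = mon_sign theta m (monomial of theta m). *)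
Definition dtheta n (A : 'I_n) (al : 'I_D) (w : sform n) : sform n := fun m y =>
  if m (gth A al) == 0%N then
    mon_sign (mon_gen (gth A al)) m * w (mon_mul (mon_gen (gth A al)) m) y
  else 0.

Definition ext n (w : sform n) : sform n :=
  \sum_A \sum_a wedge (gform (gdx A a)) (fun m => pdiff (A, a) (w m)) +
  \sum_A \sum_al wedge (gform (gdth A al)) (dtheta A al w).

(** * Generalised points and pullbacks *)

(* A point of sMink(d,1|D) parametrised by the k-fold product. *)
Record gpoint (k : nat) := Point {
  pth : 'I_D -> sform k;
  px : 'I_d.+1 -> sform k
}.

Definition coord_pt n (A : 'I_n) : gpoint n :=
  Point (fun al => gform (gth A al)) (fun a => fform (fun y => y A a)).

(* A morphism from the k-fold to the n-fold product is an n-tuple of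
   points parametrised by the k-fold product. *)
Section Pullback.
Variables (k n : nat) (phi : 'I_n -> gpoint k).

Definition body_map (y : body k) : body n :=
  \matrix_(A, a) px (phi A) a (mon1 k) y.

Definition soul (i : 'I_n * 'I_d.+1) : sform k :=
  px (phi i.1) i.2 - fform (px (phi i.1) i.2 (mon1 k)).

Definition pdiffs b (K : {ffun 'I_n * 'I_d.+1 -> 'I_b}) (f : body n -> R^o) :
    body n -> R^o :=
  foldr (fun i g => iter (K i) (pdiff i) g) f (enum {: 'I_n * 'I_d.+1}).

(* Taylor expansion around the body map; powers of a soul beyond the number
   k * D of odd coordinates vanish. *)
Definition pull_fun (f : body n -> R^o) : sform k :=
  \sum_(K : {ffun 'I_n * 'I_d.+1 -> 'I_(k * D).+1})
    (\prod_i (K i)`!%:R)^-1 *: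
    wedge (fform (pdiffs K f \o body_map))
          (\big[@wedge k/@form1 k]_(i <- enum {: 'I_n * 'I_d.+1})
             wpow (soul i) (K i)).

Definition pull_gen (g : generator n) : sform k :=
  match g with
  | inl (inl (A, al)) => pth (phi A) al
  | inl (inr (A, a)) => ext (px (phi A) a)
  | inr (A, al) => ext (pth (phi A) al)
  end.

Definition pull_mon (q : monomial n) : sform k :=
  \big[@wedge k/@form1 k]_(g <- enum (generator n)) wpow (pull_gen g) (q g).

(* Pullback preserves the form degree, so only the finitely many monomials q
   with the form degree of m contribute to the coefficient at m; their
   exponents are at most max 1 (mon_deg m). *)
Definition pull (w : sform n) : sform k := fun m y =>
  \sum_(q : {ffun generator n -> 'I_(mon_deg m).+2} |
          mon_valid (mon_bounded q) && (mon_deg (mon_bounded q) == mon_deg m))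
    wedge (pull_fun (w (mon_bounded q))) (pull_mon (mon_bounded q)) m y.

End Pullback.

(* theta M theta' = theta^al M_(al be) theta'^be *)
Definition bil n (M : 'M[R]_D) (u v : 'I_D -> sform n) : sform n :=
  \sum_al \sum_be M al be *: wedge (u al) (v be).

End Superforms.

(** * The Lie supergroup, its nerve and the Green-Schwarz forms *)

Section SMink.
Variables (R : realType) (d D : nat).
Variables (Gam : 'I_d.+1 -> 'M[R]_D) (C : 'M[R]_D).

Notation sform := (sform R d D).
Notation gpoint := (gpoint R d D).
Notation GL := (Gbar Gam C).
Notation GU := (GbarU Gam C).

Definition mulT n (p q : gpoint n) : gpoint n :=
  Point (fun al => pth p al + pth q al)
        (fun a => px p a + px q a - 2^-1 *: bil (GU a) (pth p) (pth q)).

(* With 0-based factors : the target factor j is the source factor j if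
   j + 1 < i, the product of the source factors j and j + 1 if j + 1 = i, and
   the source factor j + 1 if j + 1 > i. *)
Definition face n (i : 'I_n.+2) (j : 'I_n) : gpoint n.+1 :=
  let p := coord_pt R d D (widen_ord (leqnSn n) j) in
  let q := coord_pt R d D (lift ord0 j) in
  if (j.+1 < i)%N then p else if j.+1 == i then mulT p q else q.

Definition Delta n (w : sform n) : sform n.+1 :=
  \sum_(i < n.+2) (-1) ^+ i *: pull (face i) w.

(* Cocycles of total degree 4 in the double complex, with the signs of the
   total differential absorbed in the components. *)
Definition deRham_4cocycle (w0 : sform 0) (w1 : sform 1) (w2 : sform 2)
    (w3 : sform 3) (w4 : sform 4) : Prop :=
  [/\ superform 4 w0, superform 3 w1, superform 2 w2, superform 1 w3
    & superform 0 w4] /\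
  (ext w0 = 0 /\
   [/\ Delta w0 = ext w1, Delta w1 = ext w2, Delta w2 = ext w3,
       Delta w3 = ext w4 & Delta w4 = 0]).

Section InvariantForms.
Variables (n : nat) (p : gpoint n).

Definition sigmaL (al : 'I_D) : sform n := ext (pth p al).

Definition eL (a : 'I_d.+1) : sform n :=
  ext (px p a) + 2^-1 *: bil (GU a) (pth p) (fun al => ext (pth p al)).

Definition eR (a : 'I_d.+1) : sform n :=
  ext (px p a) - 2^-1 *: bil (GU a) (pth p) (fun al => ext (pth p al)).

End InvariantForms.

Definition H_GS : sform 1 :=
  let m := coord_pt R d D (inord 0 : 'I_1) in
  \sum_a wedge (bil (GL a) (sigmaL m) (sigmaL m)) (eL m a).

Definition rho_GS : sform 2 :=
  let m1 := coord_pt R d D (inord 0 : 'I_2) in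
  let m2 := coord_pt R d D (inord 1 : 'I_2) in
  - 2 *: (\sum_a \sum_b eta R d a b *: wedge (eL m1 a) (eR m2 b))
  - 2 *: (\sum_a wedge (bil (GL a) (pth m2) (sigmaL m1))
      (eL m1 a + ext (px m2 a)
       - 6^-1 *: bil (GU a) (pth m2) (fun al => ext (pth m2 al)))).

Definition theta_GS : sform 3 :=
  let m1 := coord_pt R d D (inord 0 : 'I_3) in
  let m2 := coord_pt R d D (inord 1 : 'I_3) in
  let m3 := coord_pt R d D (inord 2 : 'I_3) in
  - (2 / 3) *: (\sum_a wedge (bil (GL a) (pth m2) (pth m3))
      (3 *: eL m1 a + 2 *: bil (GU a) (pth m2) (sigmaL m1)
       + bil (GU a) (pth m3) (sigmaL m1))).

End SMink.

(* Main.v *)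
Require Import Defs.
From mathcomp Require Import all_boot all_order all_fingroup all_algebra.
From mathcomp Require Import all_classical all_reals all_analysis.
From mathcomp Require Import ring lra.

(* All forms involved have constant coefficients, so on them the pullback and
   the exterior derivative are determined by the generators: the pullback is
   multiplicative and d is a graded derivation.  Hence the four identities may be
   read with arbitrary points m_1, m_2, ... of the supergroup in place of the
   coordinates, where e_L(m_1 m_2) = e_L(m_1) + e_L(m_2) + theta_2 Gamma sigma_1
   and e_R(m_1 m_2) = e_R(m_1) + e_R(m_2) - theta_1 Gamma sigma_2.  Expanding by
   multilinearity leaves linear combinations of the quartic expressions
   (u Gamma_a v) (w Gamma^a z) with u, v, w, z among theta_i, sigma_i, and these
   cancel by the polarised Fierz identity, whose signs are those of permuting
   v, w, z. *)

Set Implicit Arguments.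
Unset Strict Implicit.
Unset Printing Implicit Defensive.

Import Order.TTheory GRing.Theory Num.Theory.
Import numFieldNormedType.Exports.

Local Open Scope ring_scope.

(** * Monomials and the wedge product *)

Section Monomials.
Variables (R : realType) (d D n : nat).
Implicit Types (m a b c : monomial d D n) (g h : generator d D n).

(** The body coordinates x are functions, while theta, dx and dtheta are generators; x enters the
    given forms only through dx, which is why their coefficients are constant. The x-component of a
    product point has the soul -1/2 theta_1 Gamma theta_2, but on constants the Taylor expansion in
    [pull_fun] collapses to its zeroth term, so this soul is felt only through dx. The operations
    act on arbitrary families of coefficients, where the unit law, graded commutativity and
    additivity of d can fail; [supported] and [pform] delimit a domain on which they hold and carry
    both gradings, since exchange signs depend on the two together. As spinors are Grassmann odd and
    Gamma is symmetric, theta Gamma theta' is antisymmetric and sigma Gamma sigma' symmetric. The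
    constant 1/6 in [rho_GS] and the ratio 3 : 2 : 1 in [theta_GS] are exactly those for which the
    residues of the expansions are multiples of Fierz combinations. The last comparison is made at
    one monomial and one body point, where the quartic expressions are real unknowns of a linear
    identity. *)

Definition mon_par m : nat := (\sum_g m g * gen_par g)%N.

Lemma swapC g h : swap g h = swap h g.
Proof. by rewrite /swap ![(gen_deg h * _)%N]mulnC ![(gen_par h * _)%N]mulnC. Qed.

Lemma mon_mulC a b : mon_mul a b = mon_mul b a.
Proof. by apply/ffunP => g; rewrite !ffunE addnC. Qed.

Lemma mon_mulA a b c : mon_mul a (mon_mul b c) = mon_mul (mon_mul a b) c.
Proof. by apply/ffunP => g; rewrite !ffunE addnA. Qed.

Lemma mon_mul1m a : mon_mul (mon1 d D n) a = a.
Proof. by apply/ffunP => g; rewrite !ffunE. Qed.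

Lemma mon_mulK a b : mon_div (mon_mul a b) a = b.
Proof. by apply/ffunP => g; rewrite !ffunE addKn. Qed.

Lemma mon_divK a b : (forall g, (b g <= a g)%N) -> mon_mul b (mon_div a b) = a.
Proof. by move=> le_ba; apply/ffunP => g; rewrite !ffunE subnKC. Qed.

Lemma mon_degD a b : mon_deg (mon_mul a b) = (mon_deg a + mon_deg b)%N.
Proof.
by rewrite -big_split; apply: eq_bigr => g _; rewrite ffunE mulnDl.
Qed.

Lemma mon_parD a b : mon_par (mon_mul a b) = (mon_par a + mon_par b)%N.
Proof.
by rewrite -big_split; apply: eq_bigr => g _; rewrite ffunE mulnDl.
Qed.

Lemma mon_deg1 : mon_deg (mon1 d D n) = 0%N.
Proof. by apply: big1 => g _; rewrite ffunE. Qed.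

Lemma mon_par1 : mon_par (mon1 d D n) = 0%N.
Proof. by apply: big1 => g _; rewrite ffunE. Qed.

Lemma mon_deg_gen g : mon_deg (mon_gen g) = gen_deg g.
Proof.
rewrite /mon_deg (bigD1 g) //= ffunE eqxx mul1n big1 ?addn0 // => h.
by rewrite ffunE => /negbTE ->.
Qed.

Lemma mon_par_gen g : mon_par (mon_gen g) = gen_par g.
Proof.
rewrite /mon_par (bigD1 g) //= ffunE eqxx mul1n big1 ?addn0 // => h.
by rewrite ffunE => /negbTE ->.
Qed.

Lemma mon_valid_le a b : (forall g, (a g <= b g)%N) -> mon_valid b -> mon_valid a.
Proof.
move=> le_ab /forallP vb; apply/forallP => g; apply/implyP => og.
by apply: leq_trans (le_ab g) _; have /implyP := vb g; apply.
Qed.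

Lemma mon_valid_mull a b : mon_valid (mon_mul a b) -> mon_valid a.
Proof. by apply: mon_valid_le => g; rewrite ffunE leq_addr. Qed.

Lemma mon_valid_mulr a b : mon_valid (mon_mul a b) -> mon_valid b.
Proof. by apply: mon_valid_le => g; rewrite ffunE leq_addl. Qed.

Lemma mon_valid1 : mon_valid (mon1 d D n).
Proof. by apply/forallP => g; rewrite ffunE implybT. Qed.

Lemma mon_valid_gen g : mon_valid (mon_gen g).
Proof. by apply/forallP => h; rewrite ffunE leq_b1 implybT. Qed.

Lemma mon_signMl a b c :
  mon_sign R (mon_mul a b) c = mon_sign R a c * mon_sign R b c.
Proof.
rewrite /mon_sign -exprD -big_split; congr (_ ^+ _); apply: eq_bigr => g _ /=.
by rewrite -big_split; apply: eq_bigr => h _ /=; rewrite ffunE !mulnDl.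
Qed.

Lemma mon_signMr a b c :
  mon_sign R a (mon_mul b c) = mon_sign R a b * mon_sign R a c.
Proof.
rewrite /mon_sign -exprD -big_split; congr (_ ^+ _); apply: eq_bigr => g _ /=.
rewrite -big_split; apply: eq_bigr => h _ /=; rewrite ffunE.
by rewrite mulnDr mulnDl.
Qed.

Lemma mon_sign1l a : mon_sign R (mon1 d D n) a = 1.
Proof.
rewrite /mon_sign big1 // => g _; apply: big1 => h _.
by rewrite ffunE.
Qed.

Lemma mon_sign1r a : mon_sign R a (mon1 d D n) = 1.
Proof.
rewrite /mon_sign big1 // => g _; apply: big1 => h _.
by rewrite ffunE muln0.
Qed.

Lemma mon_sign_sqr a b : mon_sign R a b * mon_sign R a b = 1.
Proof. by rewrite -expr2 sqrr_sign. Qed.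

(** The exponent on the right is a sum over all pairs (g, h). Pairs with g after h give the sign of
    a b, pairs with g before h that of b a, and the diagonal is even: if [swap g g] is odd, validity
    of the product leaves g in at most one of a and b. *)
Lemma mon_signC a b : mon_valid (mon_mul a b) ->
  mon_sign R a b =
  (-1) ^+ (mon_deg a * mon_deg b + mon_par a * mon_par b) * mon_sign R b a.
Proof.
move=> v.
pose s (x y : monomial d D n) :=
  (\sum_g \sum_(h | enum_rank h < enum_rank g) x g * y h * swap g h)%N.
have -> : (mon_deg a * mon_deg b + mon_par a * mon_par b =
   s a b + s b a + \sum_g a g * b g * swap g g)%N.
  transitivity (\sum_g \sum_h a g * b h * swap g h)%N.
    rewrite /mon_deg /mon_par !big_distrlr -big_split; apply: eq_bigr => g _ /=.
    by rewrite -big_split; apply: eq_bigr => h _ /=; rewrite /swap; ring.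
  have -> : s b a = (\sum_g \sum_(h | enum_rank g < enum_rank h) a g * b h * swap g h)%N.
    rewrite /s; under eq_bigr do rewrite big_mkcond.
    rewrite exchange_big; apply: eq_bigr => g _ /=; rewrite [RHS]big_mkcond.
    by apply: eq_bigr => h _; case: ifP => // _; rewrite swapC; ring.
  rewrite -!big_split; apply: eq_bigr => g _ /=.
  rewrite (bigD1 g) //= addnC; congr addn.
  rewrite (bigID (fun h => (enum_rank h < enum_rank g)%N)) /=; congr addn.
    by apply: eq_bigl => h; case: eqP => [->|_] /=; rewrite ?ltnn.
  apply: eq_bigl => h; rewrite -leqNgt andbC [RHS]ltn_neqAle.
  by rewrite (inj_eq val_inj) (inj_eq enum_rank_inj) andbC eq_sym.
have -> : (-1) ^+ (s a b + s b a + \sum_g a g * b g * swap g g) =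
    mon_sign R a b * mon_sign R b a.
  rewrite exprD expr_sum.
  rewrite big1 ?mulr1 ?exprD // => g _.
  rewrite -signr_odd; case: (boolP (odd (swap g g))) => og; last first.
    by rewrite oddM (negbTE og) andbF.
  have /forallP/(_ g)/implyP/(_ og) := v; rewrite ffunE.
  by case: (a g) => [|[|x]]; case: (b g) => [|[|y]] //=; rewrite ?mul0n ?muln0.
by rewrite -mulrA mon_sign_sqr mulr1.
Qed.

Lemma mon_bounded_inj N : injective (@mon_bounded d D n N).
Proof.
by move=> k l /ffunP e; apply/ffunP => g; apply: val_inj; move: (e g); rewrite !ffunE.
Qed.

Lemma mon_boundedP N m : (forall g, (m g <= N)%N) ->
  exists k : {ffun generator d D n -> 'I_N.+1}, mon_bounded k = m.
Proof.
move=> le_m; exists [ffun g => inord (m g)]; apply/ffunP => g.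
by rewrite !ffunE /= inordK // ltnS.
Qed.

(** A Kronecker delta over bounded exponent vectors; it introduces and removes dummy monomials in
    finite sums whose bounds differ. *)
Lemma sum_mon_bounded N m (F : monomial d D n -> R) : (forall g, (m g <= N)%N) ->
  \sum_(k : {ffun generator d D n -> 'I_N.+1})
     (if mon_bounded k == m then F (mon_bounded k) else 0) = F m.
Proof.
move=> /mon_boundedP [k <-]; rewrite (bigD1 k) //= eqxx big1 ?addr0 // => l.
by rewrite (inj_eq (@mon_bounded_inj _)) => /negbTE ->.
Qed.

End Monomials.

(** * Wedge product: associativity, graded commutativity, monomial basis *)

Section Wedge.
Variables (R : realType) (d D n : nat).
Implicit Types (u v w : sform R d D n) (m q : monomial d D n).

(* The index sets of [wedge] depend on the monomial; a common bound N makes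
   associativity an exchange of sums. *)
Lemma wedge_pairE N u v m y : (forall g, (m g <= N)%N) ->
  wedge u v m y = if mon_valid m then
    \sum_(k : {ffun generator d D n -> 'I_N.+1})
    \sum_(l : {ffun generator d D n -> 'I_N.+1})
     if mon_mul (mon_bounded k) (mon_bounded l) == m then
       mon_sign R (mon_bounded k) (mon_bounded l) *
         (u (mon_bounded k) y * v (mon_bounded l) y) else 0
  else 0.
Proof.
move=> leN; rewrite /wedge; case: ifP => // _.
pose F q := mon_sign R q (mon_div m q) * (u q y * v (mon_div m q) y).
transitivity (\sum_(k : {ffun generator d D n -> 'I_N.+1} |
            [forall g, (k g <= m g)%N]) F (mon_bounded k)); last first.
  rewrite big_mkcond; apply: eq_bigr => k _.
  case: ifP => [/forallP le_km|/negbT nle]; last first.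
    rewrite big1 // => l _; case: eqP => // e; case/negP: nle.
    by apply/forallP => g; rewrite -e !ffunE leq_addr.
  pose G l := mon_sign R (mon_bounded k) l * (u (mon_bounded k) y * v l y).
  rewrite /F -/(G (mon_div m (mon_bounded k))).
  rewrite -(@sum_mon_bounded _ _ _ _ N (mon_div m (mon_bounded k)) G); last first.
    by move=> g; rewrite !ffunE (leq_trans (leq_subr _ _)).
  apply: eq_bigr => l _; congr (if _ then _ else _); apply/eqP/eqP => [->|<-].
    by apply: mon_divK => g; rewrite ffunE; exact: le_km.
  by rewrite mon_mulK.
have mE (k : {ffun generator d D n -> 'I_N.+1}) g : (k g <= m g)%N ->
    (inord (k g) : 'I_(\sum_g m g).+1) = k g :> nat.
  move=> le_k; rewrite inordK // ltnS (leq_trans le_k) //.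
  by rewrite (bigD1 g) //= leq_addr.
(* Exponent vectors below m fit under both bounds, N and the total exponent of m, so casting each
   exponent with [inord] loses nothing in either direction. *)
rewrite (reindex_onto (fun k : {ffun generator d D n -> 'I_N.+1} => [ffun g => inord (k g)])
  (fun k => [ffun g => inord (k g)])) /=; last first.
  move=> k /forallP le_k; apply/ffunP => g; apply: val_inj.
  by rewrite !ffunE /= !inordK // ltnS ?(leq_trans (le_k g)).
have kE (k : {ffun generator d D n -> 'I_N.+1}) : [forall g, (k g <= m g)%N] ->
   mon_bounded [ffun g => inord (k g) : 'I_(\sum_g m g).+1] = mon_bounded k.
  by move=> /forallP le_k; apply/ffunP => g; rewrite !ffunE /= mE.
apply: eq_big => [k|k].
  apply/andP/idP => [[/forallP le_k /eqP <-]|le_k].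
    apply/forallP => g; have := le_k g; rewrite !ffunE => le_kg.
    by rewrite inordK // ltnS (leq_trans le_kg).
  split.
    by apply/forallP => g; rewrite ffunE mE ?(forallP le_k).
  by apply/eqP/ffunP => g; apply: val_inj; rewrite !ffunE /= mE;
    rewrite ?(forallP le_k) // inord_val.
case/andP => /forallP le_k /eqP ek; rewrite kE //.
apply/forallP => g; have := le_k g; rewrite -{2}ek !ffunE => le_kg.
by rewrite inordK // ltnS (leq_trans le_kg).
Qed.

Definition bound m := (\sum_g m g)%N.

Lemma le_bound m g : (m g <= bound m)%N.
Proof. by rewrite /bound (bigD1 g) //= leq_addr. Qed.

Lemma wedgeDl u v w : wedge (u + v) w = wedge u w + wedge v w.
Proof.
apply/funext => m; apply/funext => y; rewrite !fctE /wedge.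
case: ifP => _; last by rewrite addr0.
by rewrite -big_split; apply: eq_bigr => k _ /=; rewrite !fctE mulrDl mulrDr.
Qed.

Lemma wedgeDr u v w : wedge u (v + w) = wedge u v + wedge u w.
Proof.
apply/funext => m; apply/funext => y; rewrite !fctE /wedge.
case: ifP => _; last by rewrite addr0.
by rewrite -big_split; apply: eq_bigr => k _ /=; rewrite !fctE !mulrDr.
Qed.

Lemma wedgeZl (c : R) u v : wedge (c *: u) v = c *: wedge u v.
Proof.
apply/funext => m; apply/funext => y; rewrite !fctE /wedge.
case: ifP => _; last by rewrite scaler0.
rewrite scaler_sumr; apply: eq_bigr => k _ /=; rewrite !fctE.
by rewrite /GRing.scale /=; ring.
Qed.

Lemma wedgeZr (c : R) u v : wedge u (c *: v) = c *: wedge u v.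
Proof.
apply/funext => m; apply/funext => y; rewrite !fctE /wedge.
case: ifP => _; last by rewrite scaler0.
rewrite scaler_sumr; apply: eq_bigr => k _ /=; rewrite !fctE.
by rewrite /GRing.scale /=; ring.
Qed.

Lemma wedge0l u : wedge 0 u = 0.
Proof. by have := wedgeZl 0 0 u; rewrite !scale0r. Qed.

Lemma wedge0r u : wedge u 0 = 0.
Proof. by have := wedgeZr 0 u 0; rewrite !scale0r. Qed.

Lemma wedge_suml (I : Type) (r : seq I) (P : pred I) (F : I -> sform R d D n) v :
  wedge (\sum_(i <- r | P i) F i) v = \sum_(i <- r | P i) wedge (F i) v.
Proof.
exact: (big_morph (fun x => wedge x v) (fun x y => wedgeDl x y v) (wedge0l v)).
Qed.

Lemma wedge_sumr (I : Type) (r : seq I) (P : pred I) (F : I -> sform R d D n) u :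
  wedge u (\sum_(i <- r | P i) F i) = \sum_(i <- r | P i) wedge u (F i).
Proof.
exact: (big_morph (wedge u) (wedgeDr u) (wedge0r u)).
Qed.

(** Both bracketings expand to the same sum [T] over triples of monomials with product m: the sign
    is multiplicative in each argument, so in either order it is the product of the signs of the
    three pairs. *)
Lemma wedgeA u v w : wedge u (wedge v w) = wedge (wedge u v) w.
Proof.
apply/funext => m; apply/funext => y.
have leN := le_bound m; rewrite !(wedge_pairE _ _ _ leN).
case: ifP => // vm; set N := bound m in leN *.
pose mb : {ffun generator d D n -> 'I_N.+1} -> monomial d D n := @mon_bounded d D n N.+1.
pose T a b c := if mon_mul (mon_mul (mb a) (mb b)) (mb c) == m then
  mon_sign R (mb a) (mb b) * mon_sign R (mb a) (mb c) * mon_sign R (mb b) (mb c) *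
  (u (mb a) y * v (mb b) y * w (mb c) y) else 0.
transitivity (\sum_a \sum_b \sum_c T a b c).
  apply: eq_bigr => a _.
  (* The monomial of the inner product becomes a dummy index [l] constrained to equal b c. It
     divides the valid monomial m, hence is valid, and the inner wedge is not truncated there. *)
  transitivity (\sum_l \sum_b \sum_c if mb l == mon_mul (mb b) (mb c) then
     T a b c else 0).
    apply: eq_bigr => l _; case: eqP => e; last first.
      rewrite big1 // => b _; rewrite big1 // => c _; case: eqP => // e'.
      by rewrite /T -mon_mulA -e'; case: eqP.
    rewrite (@wedge_pairE N); last first.
      by move=> g; apply: leq_trans (leN g); rewrite -e !ffunE leq_addl.
    rewrite (mon_valid_mulr (_ : mon_valid (mon_mul (mb a) (mb l)))) ?e //.
    rewrite !mulr_sumr; apply: eq_bigr => b _; rewrite !mulr_sumr.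
    apply: eq_bigr => c _; rewrite -/(mb b) -/(mb c) -/(mb a) -/(mb l).
    rewrite (eq_sym (mb l)).
    case: eqP => e'; last by rewrite !mulr0.
    by rewrite /T -mon_mulA e' e eqxx -e' mon_signMr; ring.
  rewrite exchange_big; apply: eq_bigr => b _.
  rewrite exchange_big; apply: eq_bigr => c _ /=.
  have [e|ne] := eqVneq (mon_mul (mon_mul (mb a) (mb b)) (mb c)) m.
    apply: (@sum_mon_bounded _ _ _ _ N (mon_mul (mb b) (mb c)) (fun=> T a b c)) => g.
    apply: leq_trans (leN g).
    by rewrite -e -mon_mulA !ffunE leq_addl.
  by rewrite /T (negbTE ne) big1 // => l _; case: ifP.
rewrite [RHS]exchange_big /= [LHS](eq_bigr _ (fun a _ => exchange_big _ _ _ _ _ _)) /=.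
rewrite [LHS]exchange_big /=; apply: eq_bigr => c _.
transitivity (\sum_l \sum_a \sum_b if mb l == mon_mul (mb a) (mb b) then
     T a b c else 0).
  rewrite [RHS]exchange_big; apply: eq_bigr => a _ /=.
  rewrite [RHS]exchange_big; apply: eq_bigr => b _ /=.
  have [e|ne] := eqVneq (mon_mul (mon_mul (mb a) (mb b)) (mb c)) m.
    symmetry.
    apply: (@sum_mon_bounded _ _ _ _ N (mon_mul (mb a) (mb b)) (fun=> T a b c)) => g.
    apply: leq_trans (leN g).
    by rewrite -e !ffunE leq_addr.
  by rewrite /T (negbTE ne) big1 // => l _; case: ifP.
apply: eq_bigr => l _; case: eqP => e; last first.
  rewrite big1 // => a _; rewrite big1 // => b _; case: eqP => // e'.
  by rewrite /T -e'; case: eqP.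
rewrite (@wedge_pairE N); last first.
  by move=> g; apply: leq_trans (leN g); rewrite -e !ffunE leq_addr.
rewrite (mon_valid_mull (_ : mon_valid (mon_mul (mb l) (mb c)))) ?e //.
rewrite mulr_suml mulr_sumr; apply: eq_bigr => a _; rewrite mulr_suml mulr_sumr.
apply: eq_bigr => b _; rewrite -/(mb b) -/(mb c) -/(mb a) -/(mb l).
rewrite (eq_sym (mb l)).
case: eqP => e'; last by rewrite mul0r !mulr0.
by rewrite /T e' e eqxx -e' mon_signMl; ring.
Qed.

(** Homogeneity for both gradings. Validity is included because a family may have coefficients at
    invalid monomials, which every wedge product discards; the unit law needs them to be zero. *)
Definition supported p (s : bool) u :=
  forall m, u m != 0 -> [/\ mon_valid m, mon_deg m = p & odd (mon_par m) = s].

Lemma wedgeC p s p' s' u v : supported p s u -> supported p' s' v ->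
  wedge u v = (-1) ^+ (p * p' + s * s') *: wedge v u.
Proof.
move=> su sv; apply/funext => m; apply/funext => y.
rewrite !fctE !(wedge_pairE _ _ _ (le_bound m)); case: ifP => vm; last first.
  by rewrite scaler0.
rewrite exchange_big scaler_sumr; apply: eq_bigr => l _.
rewrite scaler_sumr; apply: eq_bigr => k _.
rewrite [mon_mul (mon_bounded l) _]mon_mulC.
case: eqP => e; last by rewrite scaler0.
have [u0 | /su [_ <- <-]] := eqVneq (u (mon_bounded k)) 0.
  have -> : u (mon_bounded k) y = 0 by rewrite u0.
  by rewrite mul0r !mulr0 scaler0.
have [v0 | /sv [_ <- <-]] := eqVneq (v (mon_bounded l)) 0.
  have -> : v (mon_bounded l) y = 0 by rewrite v0.
  by rewrite mul0r !mulr0 scaler0.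
rewrite (mon_signC R (_ : mon_valid (mon_mul _ _))) ?e // !exprD mulnb -oddM signr_odd.
by rewrite /GRing.scale /= [v _ y * _]mulrC !mulrA.
Qed.

Definition mono q : sform R d D n := fun m _ => if m == q then 1 else 0.

Lemma gformE g : gform g = mono (mon_gen g).
Proof. by []. Qed.

Lemma form1E : @form1 R d D n = mono (mon1 d D n).
Proof. by []. Qed.

Lemma wedge_monoE q v m y : wedge (mono q) v m y =
  if mon_valid m && [forall g, (q g <= m g)%N] then
    mon_sign R q (mon_div m q) * v (mon_div m q) y else 0.
Proof.
rewrite /wedge; case: ifP => //= vm.
pose F k := mon_sign R k (mon_div m k) * (mono q k y * v (mon_div m k) y).
case: ifP => [/forallP|/negbT] le_q; last first.
  rewrite big1 // => k /forallP le_k; rewrite /mono; case: eqP => e; last first.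
    by rewrite mul0r mulr0.
  by case/negP: le_q; apply/forallP => g; rewrite -e ffunE; exact: le_k.
have [k ek] : exists k : {ffun generator d D n -> 'I_(\sum_g m g).+1},
    mon_bounded k = q.
  by apply: mon_boundedP => g; apply: leq_trans (le_q g) (le_bound m g).
rewrite (bigD1 k) /=; last first.
  by apply/forallP => g; have := le_q g; rewrite -ek ffunE.
rewrite ek /mono eqxx mul1r big1 ?addr0 // => l /andP[_].
by rewrite -(inj_eq (@mon_bounded_inj _ _ _ _)) ek => /negbTE ->; rewrite mul0r mulr0.
Qed.

Lemma wedge_mono q r : wedge (mono q) (mono r) =
  if mon_valid (mon_mul q r) then mon_sign R q r *: mono (mon_mul q r) else 0.
Proof.
apply/funext => m; apply/funext => y; rewrite wedge_monoE.
have [->|ne] := eqVneq m (mon_mul q r).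
  rewrite mon_mulK.
  have -> : [forall g, (q g <= mon_mul q r g)%N]
    by apply/forallP => g; rewrite ffunE leq_addr.
  by rewrite andbT; case: ifP => // _; rewrite !fctE /mono !eqxx.
transitivity (0 : R); last first.
  by case: ifP => // _; rewrite !fctE /mono (negbTE ne) scaler0.
case: ifP => // /andP[_ /forallP le_q]; rewrite /mono; case: eqP => e.
  by case/eqP: ne; rewrite -e mon_divK.
by rewrite mulr0.
Qed.

Definition validf u := forall m, ~~ mon_valid m -> u m = 0.

Lemma supported_valid p s u : supported p s u -> validf u.
Proof. by move=> su m; apply: contraNeq => /su []. Qed.

Lemma wedge_valid u v : validf (wedge u v).
Proof. by move=> m vm; apply/funext => y; rewrite /wedge (negbTE vm). Qed.

Lemma wedge1l v : validf v -> wedge (@form1 R d D n) v = v.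
Proof.
move=> vv; apply/funext => m; apply/funext => y; rewrite form1E wedge_monoE.
have -> : mon_div m (mon1 d D n) = m by apply/ffunP => g; rewrite !ffunE subn0.
rewrite mon_sign1l mul1r; case: forallP => [_|[]]; last by move=> g; rewrite ffunE.
by rewrite andbT; case: ifP => // /negbT /vv ->.
Qed.

Lemma supported0 p s : supported p s 0.
Proof. by move=> m; rewrite eqxx. Qed.

Lemma supportedD p s u v : supported p s u -> supported p s v -> supported p s (u + v).
Proof.
move=> su sv m; have [u0|/su //] := eqVneq (u m) 0.
have [v0|/sv //] := eqVneq (v m) 0.
by rewrite (_ : (u + v) m = u m + v m) // u0 v0 addr0 eqxx.
Qed.

Lemma supportedZ p s (c : R) u : supported p s u -> supported p s (c *: u).
Proof.
by move=> su m; have [u0|/su //] := eqVneq (u m) 0;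
  rewrite (_ : (c *: u) m = c *: u m) // u0 scaler0 eqxx.
Qed.

Lemma supported_wedge p s p' s' u v : supported p s u -> supported p' s' v ->
  supported (p + p') (s (+) s') (wedge u v).
Proof.
move=> su sv m; apply: contra_neqP => nm; apply/funext => y.
rewrite (wedge_pairE _ _ _ (le_bound m)); case: ifP => // vm.
rewrite big1 // => k _; rewrite big1 // => l _; case: eqP => // e.
have [u0|/su [_ dk pk]] := eqVneq (u (mon_bounded k)) 0.
  by rewrite (_ : u _ y = 0) ?mul0r ?mulr0 // u0.
have [v0|/sv [_ dl pl]] := eqVneq (v (mon_bounded l)) 0.
  by rewrite (_ : v _ y = 0) ?mulr0 // v0.
by case: nm; rewrite vm -e mon_degD mon_parD oddD dk dl pk pl.
Qed.

Lemma supported_mono q : mon_valid q -> supported (mon_deg q) (odd (mon_par q)) (mono q).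
Proof.
move=> vq m; have [-> //|ne] := eqVneq m q.
by rewrite (_ : mono q m = 0) ?eqxx //; apply/funext => y; rewrite /mono (negbTE ne).
Qed.

Lemma supported_gform g : supported (gen_deg g) (odd (gen_par g)) (gform g).
Proof.
have := supported_mono (mon_valid_gen g); rewrite mon_deg_gen mon_par_gen.
by rewrite -gformE.
Qed.

Lemma supported_form1 : supported 0 false (@form1 R d D n).
Proof.
have := supported_mono (mon_valid1 d D n).
by rewrite mon_deg1 mon_par1.
Qed.

End Wedge.

(** * Exterior derivative *)

Section ExteriorDerivative.
Variables (R : realType) (d D n : nat).
Implicit Types (u v w : sform R d D n) (m q : monomial d D n).
Implicit Types (g h : generator d D n).

Lemma wedge1r p s v : supported p s v -> wedge v (@form1 R d D n) = v.
Proof.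
move=> sv; rewrite (wedgeC sv (@supported_form1 _ _ _ _)) !muln0 expr0 scale1r.
exact: wedge1l (supported_valid sv).
Qed.

Definition const_coef u := forall m y, u m y = u m 0.

Lemma const_coef0 : const_coef 0.
Proof. by []. Qed.

Lemma const_coefD u v : const_coef u -> const_coef v -> const_coef (u + v).
Proof. by move=> cu cv m y; rewrite !fctE cu cv. Qed.

Lemma const_coefZ (c : R) u : const_coef u -> const_coef (c *: u).
Proof. by move=> cu m y; rewrite !fctE cu. Qed.

Lemma const_coef_wedge u v : const_coef u -> const_coef v -> const_coef (wedge u v).
Proof.
move=> cu cv m y; rewrite /wedge; case: ifP => // _.
by apply: eq_bigr => k _; rewrite cu cv.
Qed.

Lemma pdiff_cst (i : 'I_n * 'I_d.+1) (c : R) : pdiff i (cst c) = cst 0.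
Proof. by apply/funext => y; rewrite /pdiff derive_cst. Qed.

Lemma ext_const_coef w : const_coef w ->
  ext w = \sum_A \sum_al wedge (gform (gdth d A al)) (dtheta A al w).
Proof.
move=> cw; rewrite /ext [X in X + _]big1 ?add0r // => A _; rewrite big1 // => a _.
rewrite (_ : (fun m => _) = 0) ?wedge0r //; apply/funext => m.
rewrite (_ : w m = cst (w m 0)) ?pdiff_cst //.
by apply/funext => y; rewrite cw.
Qed.

Lemma dthetaD A al u v : dtheta A al (u + v) = dtheta A al u + dtheta A al v.
Proof.
apply/funext => m; apply/funext => y; rewrite !fctE /dtheta.
by case: ifP; rewrite ?addr0 // !fctE mulrDr.
Qed.

Lemma dthetaZ A al (c : R) u : dtheta A al (c *: u) = c *: dtheta A al u.
Proof.
apply/funext => m; apply/funext => y; rewrite !fctE /dtheta.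
by case: ifP; rewrite ?scaler0 // !fctE /GRing.scale /= mulrCA.
Qed.

(** The directional derivative is a total operation but additive only where it exists, so [extD] and
    [extZ] need this condition. Unlike [const_coef] it also covers the coordinate functions x. *)
Definition derivable_coef u :=
  forall m (i : 'I_n * 'I_d.+1) y, derivable (u m) y (delta_mx i.1 i.2).

Lemma derivable_coefD u v :
  derivable_coef u -> derivable_coef v -> derivable_coef (u + v).
Proof. by move=> du dv m i y; exact: derivableD (du m i y) (dv m i y). Qed.

Lemma const_coef_derivable u : const_coef u -> derivable_coef u.
Proof.
move=> cu m i y; rewrite (_ : u m = cst (u m 0)); first exact: derivable_cst.
by apply/funext => z; rewrite cu.
Qed.

Lemma extD u v : derivable_coef u -> derivable_coef v -> ext (u + v) = ext u + ext v.
Proof.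
move=> du dv; rewrite /ext [RHS]addrACA; congr (_ + _); rewrite -big_split;
  apply: eq_bigr => A _; rewrite -big_split; apply: eq_bigr => a _ /=;
  last by rewrite dthetaD wedgeDr.
rewrite -wedgeDr; congr wedge; apply/funext => m; apply/funext => y.
exact: deriveD (du m (A, a) y) (dv m (A, a) y).
Qed.

Lemma extZ (c : R) u : derivable_coef u -> ext (c *: u) = c *: ext u.
Proof.
move=> du; rewrite /ext scalerDr !scaler_sumr; congr (_ + _); apply: eq_bigr => A _;
  rewrite scaler_sumr; apply: eq_bigr => a _ /=; last by rewrite dthetaZ wedgeZr.
rewrite -wedgeZr; congr wedge; apply/funext => m; apply/funext => y.
exact: deriveZ (du m (A, a) y).
Qed.

Lemma mon_gen_le g m : [forall h, (mon_gen g h <= m h)%N] = (0 < m g)%N.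
Proof.
apply/forallP/idP => [/(_ g)|mg h]; first by rewrite ffunE eqxx.
by rewrite ffunE; case: eqP => [->|].
Qed.

Lemma mon_genK g m : (0 < m g)%N -> m = mon_mul (mon_gen g) (mon_div m (mon_gen g)).
Proof. by rewrite -mon_gen_le => /forallP /mon_divK ->. Qed.

Lemma gform_wedgeE g v m y : wedge (gform g) v m y =
  if mon_valid m && (0 < m g)%N then
    mon_sign R (mon_gen g) (mon_div m (mon_gen g)) * v (mon_div m (mon_gen g)) y
  else 0.
Proof. by rewrite gformE wedge_monoE mon_gen_le. Qed.

Lemma mon_valid_gth A al m : m (gth d A al) = 0%N ->
  mon_valid (mon_mul (mon_gen (gth d A al)) m) = mon_valid m.
Proof.
move=> m0; apply/idP/idP => [/mon_valid_mulr //|/forallP vm].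
apply/forallP => h; rewrite !ffunE; case: eqP => [->|_]; last exact: vm.
by rewrite m0 implybT.
Qed.

(** The graded Leibniz rule for a left derivative along theta. As theta has form degree 0, only the
    Grassmann parity of g contributes to the sign. *)
Lemma dtheta_gform_wedge A al g w : validf w ->
  dtheta A al (wedge (gform g) w) =
  (if g == gth d A al then w else 0)
  + (-1) ^+ gen_par g *: wedge (gform g) (dtheta A al w).
Proof.
move=> vw; apply/funext => m; apply/funext => y.
set t := gth d A al.
transitivity ((if g == t then w m y else 0) +
   (-1) ^+ gen_par g * wedge (gform g) (dtheta A al w) m y); last by case: ifP.
rewrite [in LHS]/dtheta -/t.
have [mt|mt] := eqVneq (m t) 0%N.
  rewrite !gform_wedgeE mon_valid_gth //.
  have [->|ne] := eqVneq g t.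
    rewrite mt andbF !ffunE eqxx mon_mulK /= mulr0 addr0 andbT.
    by case: ifPn => [_|/vw ->]; rewrite ?mulr0 // mulrA mon_sign_sqr mul1r.
  rewrite add0r ![mon_mul _ m g]ffunE ffunE (negbTE ne) add0n.
  case: ifP => [/andP[vm mg]|_]; last by rewrite mulr0 mulr0.
  set r := mon_div m (mon_gen g).
  have er : m = mon_mul (mon_gen g) r by exact: mon_genK.
  have rt : r t = 0%N by rewrite !ffunE mt.
  rewrite /dtheta -/t rt eqxx.
  have -> : mon_div (mon_mul (mon_gen t) m) (mon_gen g) = mon_mul (mon_gen t) r.
    by rewrite er mon_mulA [mon_mul (mon_gen t) _]mon_mulC -mon_mulA mon_mulK.
  rewrite [in mon_sign R _ m]er !mon_signMr.
  have /mon_signC -> : mon_valid (mon_mul (mon_gen t) (mon_gen g)).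
    apply: (@mon_valid_mull _ _ _ _ r); rewrite -mon_mulA -er mon_valid_gth //.
  rewrite !mon_deg_gen !mon_par_gen mul0n mul1n /GRing.scale /=.
  have := mon_sign_sqr R (mon_gen g) (mon_gen t).
  set a := mon_sign R (mon_gen g) (mon_gen t) => aa.
  set b := (-1) ^+ _; set c := mon_sign R _ r; set e := mon_sign R _ r.
  by rewrite -[RHS]mul1r -aa; ring.
(* Here t already occurs in m, so the left side is zero. For g = t the two terms on the right
   cancel, because validity makes t occur exactly once in m; for another g, removing it leaves t in
   place and the derivative vanishes. *)
rewrite gform_wedgeE; have [->|ne] := eqVneq g t.
  rewrite lt0n mt andbT; case: ifPn => [vm|/vw ->]; last by rewrite mulr0 addr0.
  have m1 : m t = 1%N.
    apply/eqP; rewrite eqn_leq lt0n mt andbT.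
    by have /forallP/(_ t)/implyP := vm; apply.
  rewrite /dtheta -/t !ffunE eqxx m1 /= -(mon_genK _) ?m1 //.
  by rewrite mulrA mon_sign_sqr /GRing.scale /=; ring.
rewrite add0r; case: ifP => _; last by rewrite mulr0.
rewrite /dtheta -/t !ffunE (eq_sym t) (negbTE ne) subn0 (negbTE mt).
by rewrite !mulr0.
Qed.

Definition dgen g : sform R d D n :=
  match g with inl (inl (A, al)) => gform (gdth d A al) | _ => 0 end.

Lemma const_coef_form1 : const_coef (@form1 R d D n).
Proof. by []. Qed.

Lemma ext_gform_wedge g w : const_coef w -> validf w ->
  ext (wedge (gform g) w) =
  wedge (dgen g) w + (-1) ^+ gen_deg g *: wedge (gform g) (ext w).
Proof.
move=> cw vw; rewrite !ext_const_coef //; last exact: const_coef_wedge.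
under eq_bigr do under eq_bigr do rewrite dtheta_gform_wedge // wedgeDr.
under eq_bigr do rewrite big_split.
rewrite big_split /=; congr (_ + _).
  case: g => [[[B be]|[B a]]|[B be]] /=.
  - rewrite (bigD1 B) //= (bigD1 be) //= eqxx !big1 ?addr0 // => [A neA|al neal].
      rewrite big1 // => al _; case: eqP => [[eB]|_]; last by rewrite wedge0r.
      by rewrite eB eqxx in neA.
    case: eqP => [[e]|_]; last by rewrite wedge0r.
    by rewrite e eqxx in neal.
  - by rewrite wedge0l big1 // => A _; rewrite big1 // => al _; rewrite wedge0r.
  - by rewrite wedge0l big1 // => A _; rewrite big1 // => al _; rewrite wedge0r.
rewrite wedge_sumr scaler_sumr; apply: eq_bigr => A _.
rewrite wedge_sumr scaler_sumr; apply: eq_bigr => al _.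
rewrite wedgeZr !wedgeA.
rewrite (wedgeC (@supported_gform R _ _ _ (gdth d A al)) (@supported_gform R _ _ _ g)).
rewrite wedgeZl scalerA; congr (_ *: _) => /=.
rewrite !mul1n exprD mulrC -mulrA.
have -> : (-1) ^+ odd (gen_par g) = (-1) ^+ gen_par g :> R by rewrite signr_odd.
by rewrite -expr2 sqrr_sign mulr1.
Qed.

Lemma ext_form1 : ext (@form1 R d D n) = 0.
Proof.
rewrite ext_const_coef // big1 // => A _; rewrite big1 // => al _.
rewrite (_ : dtheta _ _ _ = 0) ?wedge0r //.
apply/funext => m; apply/funext => y; rewrite /dtheta; case: ifP => // _.
rewrite /form1 /fform; case: eqP => [/ffunP/(_ (gth d A al))|]; last by rewrite mulr0.
by rewrite !ffunE eqxx.
Qed.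

Lemma ext_gform g : ext (gform g) = dgen g.
Proof.
have sg := @supported_gform R _ _ _ g.
have := ext_gform_wedge g const_coef_form1 (supported_valid (@supported_form1 R d D n)).
rewrite ext_form1 wedge0r scaler0 addr0 (wedge1r sg) => ->.
case: g sg => [[[B be]|[B a]]|[B be]] /= _; rewrite ?wedge0l //.
exact: wedge1r (@supported_gform _ _ _ _ _).
Qed.

(** The subalgebra generated over the reals by theta, dx and dtheta, with its bidegree. Being
    inductive, it reduces statements about d and about pullbacks to generators; the coordinate
    functions x do not belong to it. *)
Inductive pform : nat -> bool -> sform R d D n -> Prop :=
| pform_gform g : pform (gen_deg g) (odd (gen_par g)) (gform g)
| pform_form1 : pform 0 false (@form1 R d D n)
| pform0 p s : pform p s 0
| pformD p s u v : pform p s u -> pform p s v -> pform p s (u + v)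
| pformZ p s (c : R) u : pform p s u -> pform p s (c *: u)
| pform_wedge p s p' s' u v : pform p s u -> pform p' s' v ->
    pform (p + p') (s (+) s') (wedge u v).

Lemma pform_supported p s u : pform p s u -> supported p s u.
Proof.
elim=> {p s u} [g| |p s|p s u v _ su _ sv|p s c u _ su|p s p' s' u v _ su _ sv].
- exact: supported_gform.
- exact: supported_form1.
- exact: supported0.
- exact: supportedD.
- exact: supportedZ.
- exact: supported_wedge.
Qed.

Lemma pform_valid p s u : pform p s u -> validf u.
Proof. by move=> /pform_supported /supported_valid. Qed.

Lemma pform_const_coef p s u : pform p s u -> const_coef u.
Proof.
elim=> {p s u} [g| |p s|p s u v _ su _ sv|p s c u _ su|p s p' s' u v _ su _ sv] //.
- exact: const_coefD.
- exact: const_coefZ.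
- exact: const_coef_wedge.
Qed.

Lemma pform_sum p s (I : Type) (r : seq I) (P : pred I) (F : I -> sform R d D n) :
  (forall i, P i -> pform p s (F i)) -> pform p s (\sum_(i <- r | P i) F i).
Proof. by move=> sF; elim/big_ind: _ => //; [exact: pform0|exact: pformD]. Qed.

Lemma pformN p s u : pform p s u -> pform p s (- u).
Proof. by rewrite -scaleN1r; exact: pformZ. Qed.

Lemma pformB p s u v : pform p s u -> pform p s v -> pform p s (u - v).
Proof. by move=> pu /pformN; exact: pformD. Qed.

Lemma ext0 : ext (0 : sform R d D n) = 0.
Proof. by have := extZ 0 (const_coef_derivable const_coef0); rewrite !scale0r. Qed.

(** Induction on [u] with [v] general: in the product case the rule for u1 is applied against u2 /\
    v, and associativity collects the signs. *)
Lemma ext_wedge p s p' s' u v : pform p s u -> pform p' s' v ->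
  ext (wedge u v) = wedge (ext u) v + (-1) ^+ p *: wedge u (ext v).
Proof.
move=> pu; elim: pu p' s' v =>
  {p s u} [g| |p s|p s u1 u2 pu1 IH1 pu2 IH2|p s c u pu IH
    |p1 s1 p2 s2 u1 u2 pu1 IH1 pu2 IH2]
  p' s' v pv; have cv := pform_const_coef pv; have vv := pform_valid pv.
- by rewrite ext_gform_wedge // ext_gform.
- rewrite ext_form1 wedge0l add0r expr0 scale1r wedge1l // wedge1l //.
  rewrite ext_const_coef // => m vm; rewrite fct_sumE big1 // => A _.
  by rewrite fct_sumE big1 // => al _; exact: wedge_valid.
- by rewrite ext0 !wedge0l ext0 scaler0 addr0.
- have [c1 c2] := (pform_const_coef pu1, pform_const_coef pu2).
  rewrite wedgeDl extD; try exact/const_coef_derivable/const_coef_wedge.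
  rewrite extD; try exact: const_coef_derivable.
  rewrite (IH1 _ _ _ pv) (IH2 _ _ _ pv) !wedgeDl scalerDr.
  by rewrite addrACA.
- have cu := pform_const_coef pu.
  rewrite wedgeZl !extZ; try exact: const_coef_derivable; last first.
    exact/const_coef_derivable/const_coef_wedge.
  by rewrite (IH _ _ _ pv) !wedgeZl scalerDr !scalerA mulrC.
- rewrite -wedgeA (IH1 _ _ _ (pform_wedge pu2 pv)) (IH2 _ _ _ pv) (IH1 _ _ _ pu2).
  rewrite wedgeDl wedgeDr scalerDr !wedgeZl !wedgeZr scalerA -exprD !wedgeA.
  by rewrite addrA.
Qed.

Lemma pform_ext p s u : pform p s u -> pform p.+1 s (ext u).
Proof.
elim=> {p s u} [g| |p s|p s u v pu IHu pv IHv|p s c u pu IHu|p s p' s' u v pu IHu pv IHv].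
- rewrite ext_gform; case: g => [[[B be]|[B a]]|[B be]] /=; try exact: pform0.
  exact: (pform_gform (gdth d B be)).
- by rewrite ext_form1; exact: pform0.
- by rewrite ext0; exact: pform0.
- rewrite extD; [|exact/const_coef_derivable/(pform_const_coef pu)
    |exact/const_coef_derivable/(pform_const_coef pv)].
  exact: pformD.
- rewrite extZ; [exact: pformZ|exact/const_coef_derivable/(pform_const_coef pu)].
- rewrite (ext_wedge pu pv); apply: pformD; first exact: (pform_wedge IHu pv).
  by apply: pformZ; rewrite -addnS; exact: pform_wedge.
Qed.

Lemma pform_derivable p s u : pform p s u -> derivable_coef u.
Proof. by move=> /pform_const_coef /const_coef_derivable. Qed.

Lemma ext_pform_sum p s (I : Type) (r : seq I) (F : I -> sform R d D n) :
  (forall i, pform p s (F i)) -> ext (\sum_(i <- r) F i) = \sum_(i <- r) ext (F i).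
Proof.
move=> pF; elim: r => [|i r IH]; first by rewrite !big_nil ext0.
rewrite !big_cons extD ?IH //; first exact: pform_derivable (pF i).
exact: pform_derivable (pform_sum _ (fun i _ => pF i)).
Qed.

Lemma ext_ext p s u : pform p s u -> ext (ext u) = 0.
Proof.
elim=> {p s u} [g| |p s|p s u v pu IHu pv IHv|p s c u pu IHu|p s p' s' u v pu IHu pv IHv].
- rewrite ext_gform; case: g => [[[B be]|[B a]]|[B be]] /=; rewrite ?ext0 //.
  exact: ext_gform.
- by rewrite ext_form1 ext0.
- by rewrite !ext0.
- rewrite extD; [|exact: pform_derivable pu|exact: pform_derivable pv].
  rewrite extD; [by rewrite IHu IHv addr0|exact: pform_derivable (pform_ext pu)|].
  exact: pform_derivable (pform_ext pv).
- rewrite extZ; last exact: pform_derivable pu.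
  rewrite extZ; first by rewrite IHu scaler0.
  exact: pform_derivable (pform_ext pu).
- have [du dv] := (pform_ext pu, pform_ext pv).
  rewrite (ext_wedge pu pv) extD.
  + rewrite (ext_wedge du pv) extZ; last exact: pform_derivable (pform_wedge pu dv).
    (* The two mixed terms du /\ dv carry the signs (-1)^(p+1) and (-1)^p. *)
    rewrite (ext_wedge pu dv) IHu IHv wedge0l add0r wedge0r scaler0 addr0 -scalerDl.
    by rewrite exprS mulN1r addNr scale0r.
  + exact: pform_derivable (pform_wedge du pv).
  + exact: pform_derivable (pformZ _ (pform_wedge pu dv)).
Qed.

Lemma smooth_cst (c : R) : smooth (cst c : body R d n -> R^o).
Proof.
move=> r; suff [c' ->] : exists c' : R, foldr (@pdiff R d n) (cst c) r = cst c'.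
  by move=> y; exact: differentiable_cst.
elim: r => [|i r [c' IH]]; first by exists c.
by exists 0; rewrite /= IH pdiff_cst.
Qed.

Lemma superform_pform p s u : pform p s u -> superform p u.
Proof.
move=> pu; split=> m.
  rewrite (_ : u m = cst (u m 0)); first exact: smooth_cst.
  by apply/funext => y; rewrite (pform_const_coef pu).
by apply: contraNeq => /(pform_supported pu) [-> -> _]; rewrite eqxx.
Qed.

End ExteriorDerivative.

(** * Pullback *)

Section Pullback.
Variables (R : realType) (d D k n : nat) (phi : 'I_n -> gpoint R d D k).
Implicit Types (w : sform R d D n) (q : monomial d D n) (g h : generator d D n).

(** The substituted forms have the bidegrees of the generators they replace, hence obey the same
    exchange rules; this makes the substitution multiplicative. *)
Hypothesis supported_pull_gen :
  forall g, supported (gen_deg g) (odd (gen_par g)) (pull_gen phi g).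

Lemma supported_wpow (p : nat) s j (u : sform R d D k) :
  supported p s u -> supported (j * p) (odd j && s) (wpow u j).
Proof.
move=> su; elim: j => [|j IH] /=; first by rewrite mul0n; exact: supported_form1.
rewrite mulSn (_ : ~~ odd j && s = s (+) (odd j && s)); last by case: s {su IH}; case: odd.
exact: supported_wedge.
Qed.

(** [pull_mon] over an arbitrary list of generators, so that induction on the list is possible. *)
Definition pull_seq (r : seq (generator d D n)) q : sform R d D k :=
  \big[@wedge R d D k/@form1 R d D k]_(g <- r) wpow (pull_gen phi g) (q g).

Lemma supported_pull_seq r q :
  supported (\sum_(g <- r) q g * gen_deg g)
            (odd (\sum_(g <- r) q g * gen_par g)) (pull_seq r q).
Proof.
rewrite /pull_seq; elim: r => [|g r IH]; first by rewrite !big_nil; exact: supported_form1.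
rewrite !big_cons oddD oddM.
by apply: supported_wedge => //; exact: supported_wpow.
Qed.

(** The new factor moves to the place of g in the list, passing the power of every generator that
    comes before it. *)
Lemma pull_seq_wedge r q g : uniq r -> g \in r ->
  wedge (pull_gen phi g) (pull_seq r q) =
  (-1) ^+ (\sum_(h <- take (index g r) r) q h * swap g h) *:
    pull_seq r (mon_mul (mon_gen g) q).
Proof.
rewrite /pull_seq; elim: r => [|h r IH] //= /andP[hr ur]; rewrite inE eq_sym !big_cons.
have [hg _|ne /= gr] := eqVneq h g.
  rewrite hg big_nil expr0 scale1r wedgeA !ffunE eqxx add1n /=; congr wedge.
  apply: eq_big_seq => x xr; rewrite !ffunE; case: eqP => // e.
  by rewrite hg -e xr in hr.
rewrite big_cons wedgeA.
rewrite (wedgeC (@supported_pull_gen g) (@supported_wpow _ _ (q h) _ (@supported_pull_gen h))).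
rewrite wedgeZl -wedgeA IH // wedgeZr scalerA !ffunE (negbTE ne) add0n; congr (_ *: _).
rewrite [in RHS]exprD; congr (_ * _).
rewrite -[RHS]signr_odd -[LHS]signr_odd; congr (_ ^+ _); congr nat_of_bool.
by rewrite /swap !(oddD, oddM, oddb); do 5! case: odd.
Qed.

(** The image of such a g anticommutes with itself, so its square is zero in characteristic 0. *)
Lemma pull_seq0 r q g : g \in r -> odd (swap g g) -> (1 < q g)%N -> pull_seq r q = 0.
Proof.
rewrite /pull_seq => + og qg; elim: r => // h r IH; rewrite inE big_cons.
have [<- _|ne /= gr] := eqVneq g h; last by rewrite IH ?wedge0r.
case: (q g) qg => [|[|j]] //= _; rewrite wedgeA.
have e : wedge (pull_gen phi g) (pull_gen phi g) = 0.
  have := wedgeC (@supported_pull_gen g) (@supported_pull_gen g).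
  rewrite -signr_odd oddD !oddM !oddb.
  move: og; rewrite /swap oddD !oddM => -> /= /eqP.
  rewrite scaleN1r -addr_eq0 -mulr2n -scaler_nat scaler_eq0 pnatr_eq0 /= => /eqP //.
by rewrite e !wedge0l.
Qed.

Lemma supported_pull_mon q :
  supported (mon_deg q) (odd (mon_par q)) (pull_mon phi q).
Proof.
have := @supported_pull_seq (enum (generator d D n)) q.
by rewrite !big_enum.
Qed.

Lemma pull_mon_invalid q : ~~ mon_valid q -> pull_mon phi q = 0.
Proof.
rewrite negb_forall => /existsP[g]; rewrite negb_imply -ltnNge => /andP[og qg].
by apply: (pull_seq0 _ og qg); rewrite mem_enum.
Qed.

(** The generators listed before g are those of smaller rank, so the sign of the insertion is the
    sign of the monomial product: reordering before and after the pullback agree. *)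
Lemma pull_gen_mon g q :
  wedge (pull_gen phi g) (pull_mon phi q) =
  mon_sign R (mon_gen g) q *: pull_mon phi (mon_mul (mon_gen g) q).
Proof.
have ge : g \in enum (generator d D n) by rewrite mem_enum.
rewrite (pull_seq_wedge q (enum_uniq _) ge); congr (_ ^+ _ *: _).
transitivity (\sum_(h | (enum_rank h < enum_rank g)%N) q h * swap g h)%N.
  rewrite big_uniq ?take_uniq ?enum_uniq //=; apply: eq_bigl => h.
  have rankE x : enum_rank x = index x (enum (generator d D n)) :> nat.
    rewrite -[in RHS](nth_enum_rank x x) index_uniq ?enum_uniq //.
    by rewrite -cardE ltn_ord.
  rewrite in_take_leq ?index_size //; congr (_ < _)%N; exact: esym (rankE _).
rewrite [RHS](bigD1 g) //= [X in (_ = _ + X)%N]big1 ?addn0; last first.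
  by move=> h /negbTE ne; apply: big1 => x _; rewrite ffunE ne.
by apply: eq_bigr => h _; rewrite ffunE eqxx mul1n.
Qed.

Lemma pdiffs_cst b (K : {ffun 'I_n * 'I_d.+1 -> 'I_b.+1}) (c : R) :
  pdiffs K (cst c : body R d n -> R^o) = if K == [ffun=> ord0] then cst c else cst 0.
Proof.
have it j (c' : R) i : iter j (@pdiff R d n i) (cst c') = cst (if j == 0%N then c' else 0).
  by elim: j => //= j ->; rewrite pdiff_cst.
have -> : (K == [ffun=> ord0]) = all (fun i => K i == 0%N :> nat) (enum {: 'I_n * 'I_d.+1}).
  apply/eqP/allP => [-> i _|K0]; first by rewrite ffunE.
  by apply/ffunP => i; rewrite ffunE; apply/val_inj/eqP; apply: K0; rewrite mem_enum.
rewrite /pdiffs; elim: (enum _) => //= i r ->.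
by case: (all _ r); rewrite it ?andbT ?andbF; case: (_ == _).
Qed.

(** Every Taylor term except the zeroth contains a derivative of a constant, and the zeroth contains
    no power of a soul. *)
Lemma pull_fun_cst (c : R) : pull_fun phi (cst c) = c *: @form1 R d D k.
Proof.
rewrite /pull_fun (bigD1 [ffun=> ord0]) //= [X in _ + X]big1 ?addr0; last first.
  move=> K /negbTE nK; rewrite pdiffs_cst nK.
  rewrite (_ : fform _ = 0) ?wedge0l ?scaler0 //.
  by apply/funext => m; apply/funext => y; rewrite /fform; case: ifP.
rewrite pdiffs_cst eqxx big1 ?invr1 ?scale1r; last by move=> i _; rewrite ffunE.
have -> : \big[@wedge R d D k/@form1 R d D k]_(i <- enum {: 'I_n * 'I_d.+1})
    wpow (soul phi i) ([ffun=> ord0] i : 'I_(k * D).+1) = @form1 R d D k.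
  elim: (enum _) => [|i r IH]; first by rewrite big_nil.
  rewrite big_cons IH ffunE /= wedge1l //.
  exact: supported_valid (@supported_form1 _ _ _ _).
have -> : fform (cst c \o body_map phi) = c *: @form1 R d D k.
  apply/funext => m; apply/funext => y; rewrite !fctE /form1 /fform.
  by case: ifP => _; rewrite /GRing.scale /= ?mulr1 ?mulr0.
rewrite wedgeZl wedge1l //.
exact: supported_valid (@supported_form1 _ _ _ _).
Qed.

Notation bounded p := {ffun generator d D n -> 'I_p.+2}.
Notation homogeneous q p :=
  (mon_valid (mon_bounded q) && (mon_deg (mon_bounded q) == p)).

(** An exponent of theta or dx is at most 1 by validity, and dtheta has form degree 1, so its
    exponent is bounded by the form degree. The successor is needed for theta, which may occur in
    form degree 0. *)
Lemma mon_valid_bound q : mon_valid q -> forall g, (q g <= (mon_deg q).+1)%N.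
Proof.
move=> /forallP vq g; case og: (odd (swap g g)).
  by have := vq g; rewrite og => /leq_trans; apply.
have dg : gen_deg g = 1%N by case: g og => [[[A al]|[A a]]|[A al]].
by rewrite ltnW // ltnS /mon_deg (bigD1 g) //= dg muln1 leq_addr.
Qed.

(** In [pull] the index set depends on the monomial m at which the result is read. For a homogeneous
    form it can be fixed once: in other degrees one side vanishes because w does, the other because
    [pull_mon] preserves the degree. *)
Lemma pullE p s w : const_coef w -> supported p s w ->
  pull phi w = \sum_(q : bounded p | homogeneous q p)
    w (mon_bounded q) 0 *: pull_mon phi (mon_bounded q).
Proof.
move=> cw sw; apply/funext => m; apply/funext => y; rewrite /pull fct_sumE fct_sumE.
have wE q : w q = cst (w q 0) by apply/funext => z; rewrite cw.
have vp q : validf (pull_mon phi q) by exact: supported_valid (@supported_pull_mon q).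
have [e|ne] := eqVneq (mon_deg m) p.
  rewrite e; apply: eq_bigr => q _; rewrite [in LHS]wE pull_fun_cst wedgeZl wedge1l //.
rewrite !big1 // => q /andP[vq /eqP dq].
  have := @supported_pull_mon (mon_bounded q) m.
  rewrite fctE fctE; have [-> _|_ /(_ isT) [_ e]] := eqVneq; first exact: scaler0.
  by case/eqP: ne; rewrite e.
have [w0|/sw [_ e]] := eqVneq (w (mon_bounded q)) 0; last by case/eqP: ne; rewrite -e.
by rewrite w0 (pull_fun_cst 0) scale0r wedge0l.
Qed.

Lemma supported_scale_mono s p w (q : monomial d D n) : supported p s w ->
  supported p s (w q 0 *: @mono R d D n q).
Proof.
move=> sw; have [->|/sw [vq <- <-]] := eqVneq (w q) 0.
  by rewrite scale0r; exact: supported0.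
by apply: supportedZ; exact: supported_mono.
Qed.

(** The powers of dtheta make the set of valid monomials infinite, but a fixed form degree leaves
    finitely many, so the expansion is a genuine finite sum. *)
Lemma mono_decomposition p s w : const_coef w -> supported p s w ->
  w = \sum_(q : bounded p | homogeneous q p)
    w (mon_bounded q) 0 *: mono (mon_bounded q).
Proof.
move=> cw sw; apply/funext => m; apply/funext => y; rewrite !fct_sumE.
transitivity (\sum_(q : bounded p | homogeneous q p)
  if mon_bounded q == m then w (mon_bounded q) y else 0); last first.
  apply: eq_bigr => q _; rewrite !fctE /mono eq_sym /GRing.scale /= -(cw _ y).
  by case: eqP => _; rewrite ?mulr1 ?mulr0.
rewrite big_mkcond /=.
transitivity (\sum_(q : bounded p) if mon_bounded q == m then w (mon_bounded q) y else 0);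
  last first.
  apply: eq_bigr => q _; case: eqP => _; last by case: ifP.
  case: ifP => // /negbT nq.
  have [->//|/sw [vq dq _]] := eqVneq (w (mon_bounded q)) 0.
  by rewrite vq dq eqxx in nq.
have [w0|/sw [vm dm _]] := eqVneq (w m) 0.
  by rewrite w0 big1 // => q _; case: eqP => // ->; rewrite w0.
by rewrite (@sum_mon_bounded R d D n p.+1 m (fun q => w q y)) // -dm;
  exact: mon_valid_bound.
Qed.

Lemma pullD p s u v : const_coef u -> supported p s u -> const_coef v -> supported p s v ->
  pull phi (u + v) = pull phi u + pull phi v.
Proof.
move=> cu su cv sv; rewrite (pullE cu su) (pullE cv sv).
rewrite (pullE (const_coefD cu cv) (supportedD su sv)) -big_split.
by apply: eq_bigr => q _ /=; rewrite -scalerDl.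
Qed.

Lemma pullZ p s (c : R) u : const_coef u -> supported p s u ->
  pull phi (c *: u) = c *: pull phi u.
Proof.
move=> cu su; rewrite (pullE cu su).
rewrite (pullE (const_coefZ c cu) (@supportedZ _ _ _ _ _ _ c _ su)).
by rewrite scaler_sumr; apply: eq_bigr => q _; rewrite scalerA.
Qed.

Lemma pull0 : pull phi 0 = 0.
Proof.
rewrite (pullE (@const_coef0 _ _ _ _) (@supported0 _ _ _ _ 0 false)) big1 // => q _.
by rewrite scale0r.
Qed.

Lemma pull_mono q : mon_valid q -> pull phi (mono q) = pull_mon phi q.
Proof.
move=> vq; rewrite (pullE _ (supported_mono vq)) //.
have [q' eq'] := mon_boundedP (mon_valid_bound vq).
rewrite (bigD1 q') /= ?eq' ?vq ?eqxx // /mono eqxx scale1r big1 ?addr0 // => l /andP[_].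
by rewrite -(inj_eq (@mon_bounded_inj _ _ _ _)) eq' => /negbTE ->; rewrite scale0r.
Qed.

Lemma pull_gform g : pull phi (gform g) = pull_gen phi g.
Proof.
have vg := mon_valid_gen g; rewrite gformE pull_mono //.
have := pull_gen_mon g (mon1 d D n).
rewrite mon_sign1r scale1r mon_mulC mon_mul1m => <-.
have -> : pull_mon phi (mon1 d D n) = @form1 R d D k; last first.
  by rewrite (wedge1r (@supported_pull_gen g)).
rewrite /pull_mon; elim: (enum _) => [|h r IH]; first by rewrite big_nil.
rewrite big_cons IH ffunE /= wedge1l //.
exact: supported_valid (@supported_form1 _ _ _ _).
Qed.

Lemma pull_form1 : pull phi (@form1 R d D n) = @form1 R d D k.
Proof.
rewrite form1E pull_mono ?mon_valid1 //.
rewrite /pull_mon; elim: (enum _) => [|h r IH]; first by rewrite big_nil.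
rewrite big_cons IH ffunE /= wedge1l //.
exact: supported_valid (@supported_form1 _ _ _ _).
Qed.

Lemma pull_gform_wedge p s g w : const_coef w -> supported p s w ->
  pull phi (wedge (gform g) w) = wedge (pull_gen phi g) (pull phi w).
Proof.
move=> cw sw; rewrite [in LHS](mono_decomposition cw sw) (pullE cw sw) !wedge_sumr.
set r := index_enum _.
pose F (q : bounded p) := wedge (gform g) (w (mon_bounded q) 0 *: mono (mon_bounded q)).
have cF (q : bounded p) : const_coef (F q).
  by apply: const_coef_wedge => //; exact: const_coefZ.
have sF (q : bounded p) : supported (gen_deg g + p) (odd (gen_par g) (+) s) (F q).
  by apply: supported_wedge; [exact: supported_gform|exact: supported_scale_mono].
have step q : mon_valid q -> pull phi (wedge (gform g) (w q 0 *: mono q)) =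
    wedge (pull_gen phi g) (w q 0 *: pull_mon phi q).
  move=> vq; rewrite !wedgeZr pull_gen_mon gformE wedge_mono.
  have [w0|/sw [_ dq pq]] := eqVneq (w q) 0.
    by rewrite w0 !scale0r pull0.
  (* An invalid product is zero before the pullback, and its image is zero because the substituted
     forms satisfy the same square-zero relations. *)
  case: ifPn => [v|nv]; last by rewrite pull_mon_invalid // scaler0 !scaler0 pull0.
  rewrite scalerA (pullZ _ _ (supported_mono v)) //.
  by rewrite pull_mono // scalerA.
(* Additivity of the pullback needs constant coefficients and homogeneity of the partial sums, so
   the induction carries both along. *)
suff [] : [/\ const_coef (\sum_(q <- r | homogeneous q p) F q),
  supported (gen_deg g + p) (odd (gen_par g) (+) s)
   (\sum_(q <- r | homogeneous q p) F q) &
  pull phi (\sum_(q <- r | homogeneous q p) F q) =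
  \sum_(q <- r | homogeneous q p)
     wedge (pull_gen phi g) (w (mon_bounded q) 0 *: pull_mon phi (mon_bounded q))] by [].
elim: r => [|q r [cr sr IH]].
  by rewrite !big_nil pull0; split => //; exact: supported0.
rewrite !big_cons; case: ifP => // /andP[vq _]; split.
- exact: const_coefD.
- exact: supportedD.
- by rewrite (pullD (cF q) (sF q) cr sr) IH step.
Qed.

Lemma pull_wedge p s p' s' u v : pform p s u -> pform p' s' v ->
  pull phi (wedge u v) = wedge (pull phi u) (pull phi v).
Proof.
move=> pu; elim: pu p' s' v =>
  {p s u} [g| |p s|p s u1 u2 pu1 IH1 pu2 IH2|p s c u pu IH
    |p1 s1 p2 s2 u1 u2 pu1 IH1 pu2 IH2]
  p' s' v pv; have cv := pform_const_coef pv; have sv := pform_supported pv.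
- by rewrite (pull_gform_wedge _ cv sv) pull_gform.
- rewrite wedge1l ?pull_form1 ?wedge1l //; last exact: supported_valid sv.
  rewrite (pullE cv sv) => m vm; rewrite fct_sumE big1 // => q _.
  rewrite fctE (supported_valid (@supported_pull_mon (mon_bounded q))) //.
  by apply/funext => y; exact: mulr0.
- by rewrite wedge0l pull0 wedge0l.
- have P1 := pform_wedge pu1 pv; have P2 := pform_wedge pu2 pv.
  rewrite wedgeDl (pullD (pform_const_coef P1) (pform_supported P1)
    (pform_const_coef P2) (pform_supported P2)).
  rewrite (pullD (pform_const_coef pu1) (pform_supported pu1)
    (pform_const_coef pu2) (pform_supported pu2)).
  by rewrite (IH1 _ _ _ pv) (IH2 _ _ _ pv) wedgeDl.
- have P := pform_wedge pu pv.
  rewrite wedgeZl (pullZ _ (pform_const_coef P) (pform_supported P)).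
  by rewrite (pullZ _ (pform_const_coef pu) (pform_supported pu)) (IH _ _ _ pv) wedgeZl.
- rewrite -wedgeA (IH1 _ _ _ (pform_wedge pu2 pv)) (IH2 _ _ _ pv) (IH1 _ _ _ pu2).
  by rewrite wedgeA.
Qed.

End Pullback.

(** * Spinor bilinears under d and pullback *)

Section Bilinear.
Variables (R : realType) (d D n : nat).
Implicit Types (u v w : 'I_D -> sform R d D n) (M : 'M[R]_D).

Lemma bilDl M u v w : bil M (u + v) w = bil M u w + bil M v w.
Proof.
rewrite /bil -big_split; apply: eq_bigr => al _; rewrite -big_split /=.
by apply: eq_bigr => be _; rewrite wedgeDl scalerDr.
Qed.

Lemma bilDr M u v w : bil M u (v + w) = bil M u v + bil M u w.
Proof.
rewrite /bil -big_split; apply: eq_bigr => al _; rewrite -big_split /=.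
by apply: eq_bigr => be _; rewrite wedgeDr scalerDr.
Qed.

Lemma bil0l M u : bil M 0 u = 0.
Proof.
by rewrite /bil big1 // => al _; rewrite big1 // => be _; rewrite wedge0l scaler0.
Qed.

Lemma bil0r M u : bil M u 0 = 0.
Proof.
by rewrite /bil big1 // => al _; rewrite big1 // => be _; rewrite wedge0r scaler0.
Qed.

Lemma pform_bil p s p' s' M u v :
  (forall i, pform p s (u i)) -> (forall i, pform p' s' (v i)) ->
  pform (p + p') (s (+) s') (bil M u v).
Proof.
move=> pu pv; apply: pform_sum => al _; apply: pform_sum => be _.
exact: pformZ (pform_wedge (pu al) (pv be)).
Qed.

Lemma ext_bil p s p' s' M u v :
  (forall i, pform p s (u i)) -> (forall i, pform p' s' (v i)) ->
  ext (bil M u v) = bil M (fun i => ext (u i)) v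
                    + (-1) ^+ p *: bil M u (fun i => ext (v i)).
Proof.
move=> pu pv; have puv al be := pformZ (M al be) (pform_wedge (pu al) (pv be)).
rewrite /bil (ext_pform_sum _ (fun al => pform_sum _ (fun be _ => puv al be))).
rewrite scaler_sumr -big_split; apply: eq_bigr => al _ /=.
rewrite (ext_pform_sum _ (puv al)) scaler_sumr -big_split; apply: eq_bigr => be _ /=.
rewrite extZ; last exact: pform_derivable (pform_wedge (pu al) (pv be)).
by rewrite (ext_wedge (pu al) (pv be)) scalerDr !scalerA mulrC.
Qed.

End Bilinear.

Section PullPform.
Variables (R : realType) (d D k n : nat) (phi : 'I_n -> gpoint R d D k).
Hypothesis supported_pull_gen :
  forall g, supported (gen_deg g) (odd (gen_par g)) (pull_gen phi g).

Lemma pull_pformD p s (u v : sform R d D n) : pform p s u -> pform p s v ->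
  pull phi (u + v) = pull phi u + pull phi v.
Proof.
move=> pu pv; apply: (pullD supported_pull_gen).
- exact: pform_const_coef pu.
- exact: pform_supported pu.
- exact: pform_const_coef pv.
- exact: pform_supported pv.
Qed.

Lemma pull_pformZ p s c (u : sform R d D n) : pform p s u ->
  pull phi (c *: u) = c *: pull phi u.
Proof.
move=> pu; apply: (pullZ supported_pull_gen).
  exact: pform_const_coef pu.
exact: pform_supported pu.
Qed.

Lemma pull_pform_sum p s (I : Type) (r : seq I) (F : I -> sform R d D n) :
  (forall i, pform p s (F i)) ->
  pull phi (\sum_(i <- r) F i) = \sum_(i <- r) pull phi (F i).
Proof.
move=> pF; elim: r => [|i r IH]; first by rewrite !big_nil pull0.
by rewrite !big_cons (pull_pformD (pF i) (pform_sum _ (fun j _ => pF j))) IH.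
Qed.

Lemma pull_bil p s p' s' M (u v : 'I_D -> sform R d D n) :
  (forall i, pform p s (u i)) -> (forall i, pform p' s' (v i)) ->
  pull phi (bil M u v) = bil M (fun i => pull phi (u i)) (fun i => pull phi (v i)).
Proof.
move=> pu pv; have puv al be := pformZ (M al be) (pform_wedge (pu al) (pv be)).
rewrite /bil (pull_pform_sum _ (fun al => pform_sum _ (fun be _ => puv al be))).
apply: eq_bigr => al _; rewrite (pull_pform_sum _ (puv al)); apply: eq_bigr => be _.
rewrite (pull_pformZ _ (pform_wedge (pu al) (pv be))).
by rewrite (pull_wedge supported_pull_gen (pu al) (pv be)).
Qed.

End PullPform.

(** * Generalised points *)

Section Points.
Variables (R : realType) (d D : nat).
Variables (Gam : 'I_d.+1 -> 'M[R]_D) (C : 'M[R]_D).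

(** The x-components are not in [pform], since their coefficients are not constant. The record keeps
    what the forms see of them, namely dx and its closedness, together with the derivability needed
    to differentiate sums; the class contains the coordinate points and is stable under the group
    law. *)
Record smooth_point k (p : gpoint R d D k) : Prop := SmoothPoint {
  point_th : forall al, pform 0 true (pth p al);
  point_x : forall a, derivable_coef (px p a);
  point_dx : forall a, pform 1 false (ext (px p a));
  point_ddx : forall a, ext (ext (px p a)) = 0
}.

Arguments point_x {k p} _ a _ _ _.

Lemma point_dth k (p : gpoint R d D k) : smooth_point p ->
  forall al, pform 1 true (ext (pth p al)).
Proof. by move=> sp al; exact: pform_ext (point_th sp al). Qed.

Lemma pdiff_coord k (i : 'I_k * 'I_d.+1) A a :
  pdiff i (fun y : body R d k => y A a) = cst ((A == i.1) && (a == i.2))%:R.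
Proof.
apply/funext => y; rewrite /pdiff deriveE; last exact: differentiable_coord.
(* The coordinate is repackaged as a linear map, so that it is its own differential. *)
have @f : {linear 'M[R]_(k, d.+1) -> R}.
  by exists (fun N : 'M[R]_(_, _) => N A a); do 2![eexists]; do ?[constructor];
     rewrite ?mxE// => ? *; rewrite ?mxE//; move=> ?; rewrite !mxE.
rewrite (_ : (fun _ => _) = f) // diff_lin; last exact: coord_continuous.
by rewrite /f /= mxE.
Qed.

Lemma derivable_coef_coord k (A : 'I_k) a :
  derivable_coef (px (coord_pt R d D A) a).
Proof.
move=> m i y /=; rewrite /fform; case: eqP => _; last exact: derivable_cst.
exact/diff_derivable/differentiable_coord.
Qed.

Lemma ext_coord k (A : 'I_k) a : ext (px (coord_pt R d D A) a) = gform (gdx D A a).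
Proof.
rewrite /ext [X in _ + X]big1 ?addr0; last first.
  move=> B _; rewrite big1 // => be _; rewrite (_ : dtheta _ _ _ = 0) ?wedge0r //.
  apply/funext => m; apply/funext => y; rewrite /dtheta; case: ifP => // _ /=.
  rewrite /fform; case: eqP => [/ffunP/(_ (gth d B be))|]; last by rewrite mulr0.
  by rewrite !ffunE eqxx.
have e B b : (fun m => pdiff (B, b) (px (coord_pt R d D A) a m)) =
    (((A == B) && (a == b))%:R : R) *: @form1 R d D k.
  apply/funext => m; rewrite /= /fform; case: eqP => [->|/eqP ne].
    rewrite pdiff_coord; apply/funext => y /=.
    by rewrite !fctE /form1 /fform eqxx /GRing.scale /= mulr1.
  rewrite (pdiff_cst _ 0); apply/funext => y.
  by rewrite !fctE /form1 /fform (negbTE ne) scaler0.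
transitivity (\sum_B \sum_b
    (((A == B) && (a == b))%:R : R) *: (gform (gdx D B b) : sform R d D k)).
  apply: eq_bigr => B _; apply: eq_bigr => b _; rewrite e wedgeZr.
  by rewrite (wedge1r (@supported_gform R _ _ _ (gdx D B b))).
rewrite pair_big (bigD1 (A, a)) //= !eqxx scale1r big1 ?addr0 // => -[B b] ne /=.
case: eqP => [eB|_]; last by rewrite scale0r.
case: eqP => [eb|_]; last by rewrite scale0r.
by rewrite eB eb eqxx in ne.
Qed.

Lemma smooth_coord k (A : 'I_k) : smooth_point (coord_pt R d D A).
Proof.
split=> [al|a|a|a].
- exact: (pform_gform _ (gth d A al)).
- exact: derivable_coef_coord.
- by rewrite ext_coord; exact: (pform_gform _ (gdx D A a)).
- by rewrite ext_coord ext_gform.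
Qed.

Lemma ext_coord_th k (A : 'I_k) al :
  ext (pth (coord_pt R d D A) al) = gform (gdth d A al).
Proof. exact: ext_gform. Qed.

(** * The group law on points and the Green-Schwarz forms at points *)

Notation GL := (Gbar Gam C).
Notation GU := (GbarU Gam C).
Notation mulT := (mulT Gam C).
Notation eL := (eL Gam C).
Notation eR := (eR Gam C).

Lemma sigmaL_mulT k (p q : gpoint R d D k) : smooth_point p -> smooth_point q ->
  sigmaL (mulT p q) = sigmaL p + sigmaL q.
Proof.
move=> sp sq; apply/funext => al; apply: extD.
  exact: pform_derivable (point_th sp al).
exact: pform_derivable (point_th sq al).
Qed.

Lemma dx_mulT k (p q : gpoint R d D k) a : smooth_point p -> smooth_point q ->
  ext (px (mulT p q) a) = ext (px p a) + ext (px q a)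
    - 2^-1 *: (bil (GU a) (sigmaL p) (pth q) + bil (GU a) (pth p) (sigmaL q)).
Proof.
move=> sp sq; have pb := pform_bil (GU a) (point_th sp) (point_th sq).
rewrite /= -scaleNr extD; [|exact: derivable_coefD (point_x sp a) (point_x sq a)
  |exact: pform_derivable (pformZ _ pb)].
rewrite extD; [|exact: point_x|exact: point_x].
rewrite extZ; last exact: pform_derivable pb.
by rewrite (ext_bil _ (point_th sp) (point_th sq)) expr0 scale1r scaleNr.
Qed.

Lemma smooth_mulT k (p q : gpoint R d D k) : smooth_point p -> smooth_point q ->
  smooth_point (mulT p q).
Proof.
move=> sp sq; have pb a := pform_bil (GU a) (point_th sp) (point_th sq).
have pe a : pform 1 false (2^-1 *: (bil (GU a) (sigmaL p) (pth q)
     + bil (GU a) (pth p) (sigmaL q))).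
  apply: pformZ; apply: pformD.
    exact: (pform_bil (GU a) (point_dth sp) (point_th sq)).
  exact: (pform_bil (GU a) (point_th sp) (point_dth sq)).
split=> [al|a|a|a].
- exact: pformD (point_th sp al) (point_th sq al).
- rewrite /= -scaleNr; apply: derivable_coefD;
    last exact: pform_derivable (pformZ _ (pb a)).
  exact: derivable_coefD (point_x sp a) (point_x sq a).
- rewrite dx_mulT //; apply: pformB => //.
  exact: pformD (point_dx sp a) (point_dx sq a).
- have -> : ext (px (mulT p q) a) = ext (px p a + px q a)
      + (- 2^-1) *: ext (bil (GU a) (pth p) (pth q)).
    rewrite /= -scaleNr extD; [|exact: derivable_coefD (point_x sp a) (point_x sq a)
      |exact: pform_derivable (pformZ _ (pb a))].
    by rewrite extZ //; exact: pform_derivable (pb a).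
  rewrite (extD (point_x sp a) (point_x sq a)).
  have [dp dq] := (point_dx sp a, point_dx sq a).
  rewrite extD; [|exact: pform_derivable (pformD dp dq)|
    exact: pform_derivable (pformZ _ (pform_ext (pb a)))].
  rewrite extD; [|exact: pform_derivable dp|exact: pform_derivable dq].
  rewrite extZ; last exact: pform_derivable (pform_ext (pb a)).
  by rewrite (ext_ext (pb a)) !point_ddx // scaler0 !addr0.
Qed.

Lemma pull_gen_supported k n (phi : 'I_n -> gpoint R d D k) :
  (forall i, smooth_point (phi i)) ->
  forall g, supported (gen_deg g) (odd (gen_par g)) (pull_gen phi g).
Proof.
move=> sphi [[[A al]|[A a]]|[A al]] /=.
- exact: pform_supported (point_th (sphi A) al).
- exact: pform_supported (point_dx (sphi A) a).
- exact: pform_supported (point_dth (sphi A) al).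
Qed.

(** With natural numbers as indices, the case distinction between the three kinds of factors
    computes for numerals i and j. *)
Lemma face_inord n (i : 'I_n.+3) j : (j < n.+1)%N ->
  face Gam C i (inord j : 'I_n.+1) =
  let P l := coord_pt R d D (inord l : 'I_n.+2) in
  if (j.+1 < i)%N then P j else if j.+1 == i then mulT (P j) (P j.+1) else P j.+1.
Proof.
move=> jn /=; rewrite /face inordK //.
have -> : widen_ord (leqnSn n.+1) (inord j) = inord j.
  by apply: val_inj; rewrite /= !inordK // ltnW.
have -> : lift ord0 (inord j : 'I_n.+1) = inord j.+1.
  by apply: val_inj; rewrite /= /bump /= !inordK.
by [].
Qed.

Lemma smooth_face n (i : 'I_n.+2) j : smooth_point (face Gam C i j).
Proof.
rewrite /face; case: ifP => _; first exact: smooth_coord.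
by case: ifP => _; [apply: smooth_mulT|]; exact: smooth_coord.
Qed.

(* At e = [bilU w z] this is the quartic (u Gamma_a v) (w Gamma^a z). *)
Definition trilin k (u v : 'I_D -> sform R d D k) (e : 'I_d.+1 -> sform R d D k) :=
  \sum_a wedge (bil (GL a) u v) (e a).

Definition metric k (e f : 'I_d.+1 -> sform R d D k) :=
  \sum_a \sum_b eta R d a b *: wedge (e a) (f b).

Definition bilU k (u v : 'I_D -> sform R d D k) a := bil (GU a) u v.

Definition Hpt k (p : gpoint R d D k) := trilin (sigmaL p) (sigmaL p) (eL p).

Definition dpx k (p : gpoint R d D k) a := ext (px p a).

Definition rho_pt k (p q : gpoint R d D k) :=
  - 2 *: metric (eL p) (eR q)
  - 2 *: trilin (pth q) (sigmaL p) (eL p + dpx q - 6^-1 *: bilU (pth q) (sigmaL q)).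

Definition theta_pt k (p q r : gpoint R d D k) :=
  - (2 / 3) *: trilin (pth q) (pth r)
     (3 *: eL p + 2 *: bilU (pth q) (sigmaL p) + bilU (pth r) (sigmaL p)).

Lemma eLE k (p : gpoint R d D k) : eL p = dpx p + 2^-1 *: bilU (pth p) (sigmaL p).
Proof. by []. Qed.

Lemma eRE k (p : gpoint R d D k) : eR p = dpx p - 2^-1 *: bilU (pth p) (sigmaL p).
Proof. by []. Qed.

Lemma H_GSE : H_GS Gam C = Hpt (coord_pt R d D (inord 0)).
Proof. by []. Qed.

Lemma rho_GSE : rho_GS Gam C = rho_pt (coord_pt R d D (inord 0)) (coord_pt R d D (inord 1)).
Proof. by []. Qed.

Lemma theta_GSE : theta_GS Gam C =
  theta_pt (coord_pt R d D (inord 0)) (coord_pt R d D (inord 1)) (coord_pt R d D (inord 2)).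
Proof. by []. Qed.

(** * Bidegrees of the forms at points *)

Section PformPoints.
Variables (k : nat).
Implicit Types (p q r : gpoint R d D k).

Lemma pform_bilU n s n' s' (u v : 'I_D -> sform R d D k) :
  (forall i, pform n s (u i)) -> (forall i, pform n' s' (v i)) ->
  forall a, pform (n + n') (s (+) s') (bilU u v a).
Proof. by move=> pu pv a; exact: pform_bil. Qed.

Lemma pform_eL p a : smooth_point p -> pform 1 false (eL p a).
Proof.
move=> sp; apply: pformD (point_dx sp a) (pformZ _ _).
exact: (pform_bil (GU a) (point_th sp) (point_dth sp)).
Qed.

Lemma pform_eR p a : smooth_point p -> pform 1 false (eR p a).
Proof.
move=> sp; apply: pformB (point_dx sp a) (pformZ _ _).
exact: (pform_bil (GU a) (point_th sp) (point_dth sp)).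
Qed.

Lemma pform_trilin n s n' s' m t (u v : 'I_D -> sform R d D k) e :
  (forall i, pform n s (u i)) -> (forall i, pform n' s' (v i)) ->
  (forall a, pform m t (e a)) ->
  pform (n + n' + m) (s (+) s' (+) t) (trilin u v e).
Proof.
by move=> pu pv pe; apply: pform_sum => a _; exact: pform_wedge (pform_bil _ pu pv) (pe a).
Qed.

Lemma pform_metric n s n' s' (e f : 'I_d.+1 -> sform R d D k) :
  (forall i, pform n s (e i)) -> (forall i, pform n' s' (f i)) ->
  pform (n + n') (s (+) s') (metric e f).
Proof.
move=> pe pf; apply: pform_sum => a _; apply: pform_sum => b _.
exact: pformZ (pform_wedge (pe a) (pf b)).
Qed.

Lemma pform_Hpt p : smooth_point p -> pform 3 false (Hpt p).
Proof.
move=> sp; exact: (pform_trilin (point_dth sp) (point_dth sp) (fun a => pform_eL a sp)).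
Qed.

Lemma pform_rho_arg p q a : smooth_point p -> smooth_point q ->
  pform 1 false ((eL p + dpx q - 6^-1 *: bilU (pth q) (sigmaL q)) a).
Proof.
move=> sp sq; apply: pformB; last exact: pformZ (pform_bilU (point_th sq) (point_dth sq) a).
exact: pformD (pform_eL a sp) (point_dx sq a).
Qed.

Lemma pform_rho_pt p q : smooth_point p -> smooth_point q -> pform 2 false (rho_pt p q).
Proof.
move=> sp sq; apply: pformB; apply: pformZ.
  exact: (pform_metric (fun a => pform_eL a sp) (fun a => pform_eR a sq)).
exact: (pform_trilin (point_th sq) (point_dth sp) (fun a => pform_rho_arg a sp sq)).
Qed.

Lemma pform_theta_arg p q r a : smooth_point p -> smooth_point q -> smooth_point r ->
  pform 1 false
    ((3 *: eL p + 2 *: bilU (pth q) (sigmaL p) + bilU (pth r) (sigmaL p)) a).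
Proof.
move=> sp sq sr; apply: pformD; last exact: (pform_bilU (point_th sr) (point_dth sp) a).
apply: pformD; apply: pformZ; first exact: pform_eL.
exact: (pform_bilU (point_th sq) (point_dth sp) a).
Qed.

Lemma pform_theta_pt p q r : smooth_point p -> smooth_point q -> smooth_point r ->
  pform 1 false (theta_pt p q r).
Proof.
move=> sp sq sr; apply: pformZ.
exact: (pform_trilin (point_th sq) (point_th sr) (fun a => pform_theta_arg a sp sq sr)).
Qed.

End PformPoints.

(** * Pullback as substitution of points *)

Section PullPoints.
Variables (k n : nat) (phi : 'I_n -> gpoint R d D k).
Hypothesis sphi : forall i, smooth_point (phi i).
Let P i := coord_pt R d D (i : 'I_n).
Let sP i : smooth_point (P i) := smooth_coord i.
Let spg := pull_gen_supported sphi.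

Lemma pull_th i : (fun al => pull phi (pth (P i) al)) = pth (phi i).
Proof. by apply/funext => al; rewrite (pull_gform spg). Qed.

Lemma pull_sigmaL i : (fun al => pull phi (sigmaL (P i) al)) = sigmaL (phi i).
Proof. by apply/funext => al; rewrite /sigmaL ext_coord_th (pull_gform spg). Qed.

Lemma pull_dpx i : (fun a => pull phi (dpx (P i) a)) = dpx (phi i).
Proof. by apply/funext => a; rewrite /dpx ext_coord (pull_gform spg). Qed.

Lemma pull_trilin m s m' s' l t (u v : 'I_D -> sform R d D n) e :
  (forall i, pform m s (u i)) -> (forall i, pform m' s' (v i)) ->
  (forall a, pform l t (e a)) ->
  pull phi (trilin u v e) = trilin (fun i => pull phi (u i)) (fun i => pull phi (v i))
     (fun a => pull phi (e a)).
Proof.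
move=> pu pv pe; rewrite /trilin.
rewrite (pull_pform_sum spg _ (fun a => pform_wedge (pform_bil _ pu pv) (pe a))).
apply: eq_bigr => a _; rewrite (pull_wedge spg (pform_bil _ pu pv) (pe a)).
by rewrite (pull_bil spg _ pu pv).
Qed.

Lemma pull_metric m s m' s' (e f : 'I_d.+1 -> sform R d D n) :
  (forall i, pform m s (e i)) -> (forall i, pform m' s' (f i)) ->
  pull phi (metric e f) = metric (fun a => pull phi (e a)) (fun a => pull phi (f a)).
Proof.
move=> pe pf; have pef a b := pformZ (eta R d a b) (pform_wedge (pe a) (pf b)).
rewrite /metric (pull_pform_sum spg _ (fun a => pform_sum _ (fun b _ => pef a b))).
apply: eq_bigr => a _; rewrite (pull_pform_sum spg _ (pef a)); apply: eq_bigr => b _.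
by rewrite (pull_pformZ spg _ (pform_wedge (pe a) (pf b))) (pull_wedge spg (pe a) (pf b)).
Qed.

Lemma pull_bilU_th i j a :
  pull phi (bilU (pth (P i)) (sigmaL (P j)) a) = bilU (pth (phi i)) (sigmaL (phi j)) a.
Proof.
by rewrite /bilU (pull_bil spg _ (point_th (sP i)) (point_dth (sP j))) pull_th pull_sigmaL.
Qed.

Lemma pull_eL i : (fun a => pull phi (eL (P i) a)) = eL (phi i).
Proof.
apply/funext => a; have pb := pform_bilU (point_th (sP i)) (point_dth (sP i)) a.
rewrite eLE (pull_pformD spg (point_dx (sP i) a) (pformZ _ pb)).
by rewrite (pull_pformZ spg _ pb) pull_bilU_th [in LHS](congr1 (@^~ a) (pull_dpx i)).
Qed.

Lemma pull_eR i : (fun a => pull phi (eR (P i) a)) = eR (phi i).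
Proof.
apply/funext => a; have pb := pform_bilU (point_th (sP i)) (point_dth (sP i)) a.
rewrite eRE -scaleNr (pull_pformD spg (point_dx (sP i) a) (pformZ _ pb)).
rewrite (pull_pformZ spg _ pb) pull_bilU_th.
by rewrite [in LHS](congr1 (@^~ a) (pull_dpx i)) scaleNr.
Qed.

Lemma pull_Hpt i : pull phi (Hpt (P i)) = Hpt (phi i).
Proof.
have pe a := pform_eL a (sP i).
rewrite /Hpt (pull_trilin (point_dth (sP i)) (point_dth (sP i)) pe).
by rewrite !pull_sigmaL pull_eL.
Qed.

Lemma pull_rho_pt i j : pull phi (rho_pt (P i) (P j)) = rho_pt (phi i) (phi j).
Proof.
have pm := pform_metric (fun a => pform_eL a (sP i)) (fun a => pform_eR a (sP j)).
have pe a := pform_rho_arg a (sP i) (sP j).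
have pt := pform_trilin (point_th (sP j)) (point_dth (sP i)) pe.
rewrite /rho_pt -![- (2 *: trilin _ _ _)]scaleNr.
rewrite (pull_pformD spg (pformZ _ pm) (pformZ _ pt)).
rewrite (pull_pformZ spg _ pm) (pull_pformZ spg _ pt).
rewrite (pull_metric (fun a => pform_eL a (sP i)) (fun a => pform_eR a (sP j))).
rewrite pull_eL pull_eR.
rewrite (pull_trilin (point_th (sP j)) (point_dth (sP i)) pe).
rewrite pull_th pull_sigmaL; congr (_ + _ *: trilin _ _ _); apply/funext => a.
have pb := pform_bilU (point_th (sP j)) (point_dth (sP j)) a.
have px := point_dx (sP j) a.
rewrite -scaleNr (pull_pformD spg (pformD (pform_eL a (sP i)) px) (pformZ _ pb)).
rewrite (pull_pformD spg (pform_eL a (sP i)) px) (pull_pformZ spg _ pb).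
rewrite pull_bilU_th [pull _ (eL _ _)](congr1 (@^~ a) (pull_eL i)).
by rewrite [pull _ (ext _)](congr1 (@^~ a) (pull_dpx j)) scaleNr.
Qed.

Lemma pull_theta_pt i j l :
  pull phi (theta_pt (P i) (P j) (P l)) = theta_pt (phi i) (phi j) (phi l).
Proof.
have pe a := pform_theta_arg a (sP i) (sP j) (sP l).
rewrite /theta_pt (pull_pformZ spg _ (pform_trilin (point_th (sP j)) (point_th (sP l)) pe)).
rewrite (pull_trilin (point_th (sP j)) (point_th (sP l)) pe).
congr (_ *: trilin _ _ _); [exact: pull_th|exact: pull_th|apply/funext => a].
have p1 := pformZ 3 (pform_eL a (sP i)).
have p2 := pformZ 2 (pform_bilU (point_th (sP j)) (point_dth (sP i)) a).
have p3 := pform_bilU (point_th (sP l)) (point_dth (sP i)) a.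
rewrite (pull_pformD spg (pformD p1 p2) p3) (pull_pformD spg p1 p2).
rewrite (pull_pformZ spg _ (pform_eL a (sP i))).
rewrite (pull_pformZ spg _ (pform_bilU (point_th (sP j)) (point_dth (sP i)) a)).
transitivity (3 *: eL (phi i) a + 2 *: bilU (pth (phi j)) (sigmaL (phi i)) a
   + bilU (pth (phi l)) (sigmaL (phi i)) a); last by [].
have -> : pull phi (eL (P i) a) = eL (phi i) a by exact: (congr1 (@^~ a) (pull_eL i)).
by congr (_ *: _ + _ *: _ + _); exact: pull_bilU_th.
Qed.

End PullPoints.

End Points.

(** * Fierz identities *)

Section Trilinear.
Variables (R : realType) (d D : nat).
Variables (Gam : 'I_d.+1 -> 'M[R]_D) (C : 'M[R]_D).
Hypotheses (hmaj : majorana Gam C) (hfierz : fierz Gam C).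
Notation GL := (Gbar Gam C).
Notation GU := (GbarU Gam C).
Notation trilin := (trilin Gam C).
Notation bilU := (bilU Gam C).

Lemma eta_sym (a b : 'I_d.+1) : eta R d a b = eta R d b a.
Proof. by rewrite !mxE eq_sym; case: eqP => // ->. Qed.

Lemma eta_mul : eta R d *m eta R d = 1%:M.
Proof.
apply/matrixP => a b; rewrite !mxE (bigD1 a) //= big1 => [|c ne]; last first.
  by rewrite mxE eq_sym (negbTE ne) mul0r.
rewrite !mxE eqxx addr0; case: (a == b); rewrite ?mulr0 //.
by case: ifP; rewrite ?mulr1 ?mulrNN ?mulr1.
Qed.

Lemma eta_unit : eta R d \in unitmx.
Proof. by have /mulmx1_unit [] := eta_mul. Qed.

Lemma GbarE a : GL a = \sum_b eta R d a b *: GU b.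
Proof.
under eq_bigr do rewrite /GbarU scaler_sumr.
rewrite exchange_big /= [RHS](eq_bigr (fun c => (eta R d *m invmx (eta R d)) a c *: GL c)).
  rewrite mulmxV ?eta_unit // (bigD1 a) //= !mxE eqxx scale1r big1 ?addr0 // => c ne.
  by rewrite !mxE eq_sym (negbTE ne) scale0r.
move=> c _; rewrite mxE scaler_suml; apply: eq_bigr => b _.
by rewrite scalerA.
Qed.

Lemma GbarU_sym a : (GU a)^T = GU a.
Proof.
rewrite /GbarU linear_sum; apply: eq_bigr => b _.
by rewrite linearZ /= (maj_sym hmaj).
Qed.

Definition fierz_tensor al be ga de : R := \sum_a GL a al be * GU a ga de.

Lemma fierz_tensorE al be ga de :
  fierz_tensor al be ga de = \sum_a \sum_b eta R d a b * GU a al be * GU b ga de.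
Proof.
rewrite exchange_big; apply: eq_bigr => b _; rewrite GbarE summxE mulr_suml.
by apply: eq_bigr => a _; rewrite mxE eta_sym.
Qed.

Lemma fierz_tensor_symr al be ga de :
  fierz_tensor al be ga de = fierz_tensor al be de ga.
Proof. by apply: eq_bigr => a _; congr (_ * _); rewrite -[in LHS]GbarU_sym; exact: mxE. Qed.

(** Symmetry in the last two indices makes each term of the symmetrisation depend only on where slot
    0 is sent. Each of the three values is taken by equally many permutations, so the Fierz
    hypothesis is a nonzero multiple of the cyclic sum. *)
Lemma fierz_cyclic al be ga de :
  fierz_tensor al be ga de + fierz_tensor al ga de be + fierz_tensor al de be ga = 0.
Proof.
pose i (j : 'I_3) := nth be [:: be; ga; de] j.
pose G (j : 'I_3) := nth 0 [:: fierz_tensor al be ga de; fierz_tensor al ga de be;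
  fierz_tensor al de be ga] j.
pose N := #|[pred s : 'S_3 | s (inord 0) == inord 0]|.
have : \sum_(s : 'S_3) G (s (inord 0)) = 0.
  have /eqP := hfierz al i; rewrite mulf_eq0 invr_eq0 pnatr_eq0 /= => /eqP e.
  rewrite -[RHS]e; apply: eq_bigr => s _; rewrite -fierz_tensorE.
  (* Injectivity of s excludes the triples of images with a repetition; only the six genuine
     permutations survive the case analysis. *)
  have ne x y : (x < y < 3)%N -> s (inord x) != s (inord y) :> nat.
    move=> /andP[xy y3]; rewrite (inj_eq val_inj) (inj_eq perm_inj).
    by rewrite -val_eqE /= !inordK ?(ltn_trans xy) // neq_ltn xy.
  have := ne 0%N 1%N isT; have := ne 0%N 2%N isT; have := ne 1%N 2%N isT.
  rewrite /G /i; move: fierz_tensor fierz_tensor_symr => F symF.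
  move: (s _) (s _) (s _) => [[|[|[|x]]] hx] [[|[|[|y]]] hy] [[|[|[|z]]] hz] //=;
    by rewrite // symF.
rewrite (partition_big (fun s : 'S_3 => s (inord 0)) predT) //=.
have eN x : \sum_(s : 'S_3 | s (inord 0) == x) G (s (inord 0)) = G x *+ N.
  (* Composing with the transposition of 0 and x carries the permutations fixing 0 to those sending
     0 to x, so all three fibres have [N] elements; [N] is nonzero because of the identity. *)
  rewrite (reindex_inj (mulIg (tperm (inord 0) x))) /=.
  rewrite -sumr_const; apply: eq_big => [s|s].
    by rewrite permM -{2}(tpermL (inord 0) x) (inj_eq perm_inj).
  by move=> /eqP ->.
under eq_bigr do rewrite eN.
rewrite sumrMnl => /eqP; rewrite -mulr_natl mulf_eq0 pnatr_eq0 => /orP[/eqP N0|/eqP].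
  by have := card0_eq N0 1%g; rewrite inE perm1 eqxx.
by rewrite !big_ord_recl big_ord0 /G /= addr0 addrA.
Qed.

(** * Multilinearity, exchange and Fierz rules for quartic expressions *)

Section Forms.
Variable (n : nat).
Implicit Types (u v w z : 'I_D -> sform R d D n) (e f : 'I_d.+1 -> sform R d D n).

Lemma trilinDl u v w e : trilin (u + v) w e = trilin u w e + trilin v w e.
Proof. by rewrite -big_split; apply: eq_bigr => a _; rewrite bilDl wedgeDl. Qed.

Lemma trilinDm u v w e : trilin u (v + w) e = trilin u v e + trilin u w e.
Proof. by rewrite -big_split; apply: eq_bigr => a _; rewrite bilDr wedgeDl. Qed.

Lemma trilinDr u v e f : trilin u v (e + f) = trilin u v e + trilin u v f.
Proof. by rewrite -big_split; apply: eq_bigr => a _; rewrite wedgeDr. Qed.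

Lemma trilinZr (c : R) u v e : trilin u v (c *: e) = c *: trilin u v e.
Proof. by rewrite scaler_sumr; apply: eq_bigr => a _; rewrite wedgeZr. Qed.

Lemma trilinNr u v e : trilin u v (- e) = - trilin u v e.
Proof. by rewrite -scaleN1r trilinZr scaleN1r. Qed.

Lemma bilUDl u v w : bilU (u + v) w = bilU u w + bilU v w.
Proof. by apply/funext => a; exact: bilDl. Qed.

Lemma bilUDr u v w : bilU u (v + w) = bilU u v + bilU u w.
Proof. by apply/funext => a; exact: bilDr. Qed.

Lemma metricDl e e' f : metric (e + e') f = metric e f + metric e' f.
Proof.
rewrite -big_split; apply: eq_bigr => a _; rewrite -big_split; apply: eq_bigr => b _ /=.
by rewrite wedgeDl scalerDr.
Qed.

Lemma metricDr e f f' : metric e (f + f') = metric e f + metric e f'.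
Proof.
rewrite -big_split; apply: eq_bigr => a _; rewrite -big_split; apply: eq_bigr => b _ /=.
by rewrite wedgeDr scalerDr.
Qed.

Lemma metricZl (c : R) e f : metric (c *: e) f = c *: metric e f.
Proof.
rewrite scaler_sumr; apply: eq_bigr => a _; rewrite scaler_sumr; apply: eq_bigr => b _ /=.
by rewrite wedgeZl !scalerA mulrC.
Qed.

Lemma metricZr (c : R) e f : metric e (c *: f) = c *: metric e f.
Proof.
rewrite scaler_sumr; apply: eq_bigr => a _; rewrite scaler_sumr; apply: eq_bigr => b _ /=.
by rewrite wedgeZr !scalerA mulrC.
Qed.

Lemma metricNr e f : metric e (- f) = - metric e f.
Proof. by rewrite -scaleN1r metricZr scaleN1r. Qed.

Lemma metricC p s p' s' e f :
  (forall a, pform p s (e a)) -> (forall a, pform p' s' (f a)) ->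
  metric e f = (-1) ^+ (p * p' + s * s') *: metric f e.
Proof.
move=> pe pf; rewrite /metric exchange_big scaler_sumr; apply: eq_bigr => b _ /=.
rewrite scaler_sumr; apply: eq_bigr => a _; rewrite eta_sym.
by rewrite (wedgeC (pform_supported (pe a)) (pform_supported (pf b))) !scalerA mulrC.
Qed.

(** The metric lowers the index of Gamma^a. *)
Lemma metric_bilUl u v f : metric (bilU u v) f = trilin u v f.
Proof.
rewrite /metric exchange_big; apply: eq_bigr => b _ /=.
under eq_bigr do rewrite -wedgeZl.
rewrite -wedge_suml; congr wedge; rewrite /bilU /bil.
under eq_bigr do rewrite scaler_sumr.
rewrite exchange_big; apply: eq_bigr => al _ /=.
under eq_bigr do rewrite scaler_sumr.
rewrite exchange_big; apply: eq_bigr => be _ /=.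
rewrite GbarE summxE scaler_suml; apply: eq_bigr => a _.
by rewrite scalerA eta_sym; congr (_ *: _); rewrite [RHS]mxE.
Qed.

(** The Grassmann parity is always odd, so the form degrees p, p' alone fix the exchange sign
    (-1)^(pp'+1). *)
Definition spinor (p : nat) u := forall al, pform p true (u al).

Lemma bil_sym (M : 'M[R]_D) p p' u v : M^T = M -> spinor p u -> spinor p' v ->
  bil M u v = (-1) ^+ (p * p').+1 *: bil M v u.
Proof.
move=> sM pu pv; rewrite /bil exchange_big scaler_sumr; apply: eq_bigr => be _ /=.
rewrite scaler_sumr; apply: eq_bigr => al _; rewrite -{1}sM mxE.
rewrite (wedgeC (pform_supported (pu al)) (pform_supported (pv be))) !scalerA.
by rewrite mulrC addn1.
Qed.

Lemma trilin_sym p p' u v e : spinor p u -> spinor p' v ->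
  trilin u v e = (-1) ^+ (p * p').+1 *: trilin v u e.
Proof.
move=> pu pv; rewrite scaler_sumr; apply: eq_bigr => a _.
by rewrite (bil_sym (maj_sym hmaj a) pu pv) wedgeZl.
Qed.

Lemma bilU_sym p p' u v : spinor p u -> spinor p' v ->
  bilU u v = (-1) ^+ (p * p').+1 *: bilU v u.
Proof.
by move=> pu pv; apply/funext => a; exact: (bil_sym (GbarU_sym a) pu pv).
Qed.

Lemma metric_bilUr p s p1 p2 e u v : (forall a, pform p s (e a)) ->
  spinor p1 u -> spinor p2 v ->
  metric e (bilU u v) = (-1) ^+ (p * (p1 + p2)) *: trilin u v e.
Proof.
move=> pe pu pv; rewrite (metricC pe (fun a => pform_bilU Gam C pu pv a)).
by rewrite metric_bilUl muln0 addn0.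
Qed.

(** Both bilinears are Grassmann even, so exchanging them costs only the sign of their form degrees;
    symmetry of the metric moves the lowered index from one to the other. *)
Lemma trilinC p1 p2 p3 p4 u v w z :
  spinor p1 u -> spinor p2 v -> spinor p3 w -> spinor p4 z ->
  trilin u v (bilU w z) = (-1) ^+ ((p1 + p2) * (p3 + p4)) *: trilin w z (bilU u v).
Proof.
move=> pu pv pw pz; rewrite -metric_bilUl.
exact: (metric_bilUr (fun a => pform_bilU Gam C pu pv a) pw pz).
Qed.

Lemma trilin_bilUE u v w z : trilin u v (bilU w z) =
  \sum_al \sum_be \sum_ga \sum_de fierz_tensor al be ga de *:
    wedge (u al) (wedge (v be) (wedge (w ga) (z de))).
Proof.
rewrite /trilin.
under eq_bigr do rewrite /bil wedge_suml.
rewrite exchange_big; apply: eq_bigr => al _ /=.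
under eq_bigr do rewrite wedge_suml.
rewrite exchange_big; apply: eq_bigr => be _ /=.
under eq_bigr do rewrite /bilU /bil wedge_sumr.
rewrite exchange_big; apply: eq_bigr => ga _ /=.
under eq_bigr do rewrite wedge_sumr.
rewrite exchange_big; apply: eq_bigr => de _ /=.
rewrite scaler_suml; apply: eq_bigr => a _.
by rewrite wedgeZl wedgeZr scalerA -!wedgeA.
Qed.

Lemma trilin_fierz p2 p3 p4 u v w z : spinor p2 v -> spinor p3 w -> spinor p4 z ->
  trilin u v (bilU w z)
  + (-1) ^+ ((p2 * p3).+1 + (p2 * p4).+1) *: trilin u w (bilU z v)
  + (-1) ^+ ((p3 * p4).+1 + (p2 * p4).+1) *: trilin u z (bilU v w) = 0.
Proof.
move=> pv pw pz.
have swapE p p' (x y : sform R d D n) : pform p true x -> pform p' true y ->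
    wedge x y = (-1) ^+ (p * p').+1 *: wedge y x.
  by move=> px py; rewrite (wedgeC (pform_supported px) (pform_supported py)) addn1.
pose S := \sum_al \sum_be \sum_ga \sum_de (fierz_tensor al be ga de
  + fierz_tensor al ga de be + fierz_tensor al de be ga) *:
    wedge (u al) (wedge (v be) (wedge (w ga) (z de))).
have <- : S = 0.
  rewrite /S big1 // => al _; rewrite big1 // => be _; rewrite big1 // => ga _.
  by rewrite big1 // => de _; rewrite fierz_cyclic scale0r.
rewrite !trilin_bilUE !scaler_sumr -!big_split; apply: eq_bigr => al _ /=.
(* Summation indices are renamed so that v, w and z carry be, ga and de in all three terms. Two
   exchanges of neighbours then bring the factors into the order v, w, z, which accounts for the two
   summands in each sign exponent. *)
have -> : \sum_be \sum_ga \sum_de fierz_tensor al be ga de *: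
    wedge (u al) (wedge (w be) (wedge (z ga) (v de))) =
  \sum_be \sum_ga \sum_de fierz_tensor al ga de be *:
    wedge (u al) (wedge (w ga) (wedge (z de) (v be))).
  rewrite [RHS]exchange_big; apply: eq_bigr => ga _ /=.
  by rewrite [RHS]exchange_big.
have -> : \sum_be \sum_ga \sum_de fierz_tensor al be ga de *:
    wedge (u al) (wedge (z be) (wedge (v ga) (w de))) =
  \sum_be \sum_ga \sum_de fierz_tensor al de be ga *:
    wedge (u al) (wedge (z de) (wedge (v be) (w ga))).
  rewrite exchange_big; apply: eq_bigr => be _ /=.
  by rewrite exchange_big.
rewrite !scaler_sumr -!big_split; apply: eq_bigr => be _ /=.
rewrite !scaler_sumr -!big_split; apply: eq_bigr => ga _ /=.
rewrite !scaler_sumr -!big_split; apply: eq_bigr => de _ /=.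
rewrite !scalerDl; congr (_ + _ + _); rewrite scalerA mulrC -scalerA; congr (_ *: _).
  rewrite -wedgeZr; congr wedge.
  rewrite [wedge (v be) _]wedgeA (swapE _ _ _ _ (pv be) (pw ga)) wedgeZl -wedgeA.
  by rewrite (swapE _ _ _ _ (pv be) (pz de)) wedgeZr scalerA exprD.
rewrite -wedgeZr; congr wedge.
rewrite (swapE _ _ _ _ (pw ga) (pz de)) wedgeZr.
rewrite [wedge (v be) (wedge _ _)]wedgeA (swapE _ _ _ _ (pv be) (pz de)).
by rewrite wedgeZl -wedgeA scalerA exprD.
Qed.

End Forms.
End Trilinear.

(** * The cocycle identities *)

Section InvariantForms.
Variables (R : realType) (d D : nat).
Variables (Gam : 'I_d.+1 -> 'M[R]_D) (C : 'M[R]_D).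
Hypotheses (hmaj : majorana Gam C) (hfierz : fierz Gam C).
Notation GU := (GbarU Gam C).
Notation trilin := (trilin Gam C).
Notation bilU := (bilU Gam C).
Notation eL := (eL Gam C).
Notation eR := (eR Gam C).
Notation mulT := (mulT Gam C).
Notation Hpt := (Hpt Gam C).
Notation rho_pt := (rho_pt Gam C).
Notation theta_pt := (theta_pt Gam C).

(** * Differentials of the invariant forms and their values on products *)

Section Forms.
Variable (n : nat).
Implicit Types (u v w z th sg : 'I_D -> sform R d D n) (e f : 'I_d.+1 -> sform R d D n).
Implicit Types (p q r : gpoint R d D n).

Lemma trilin0l u e : trilin 0 u e = 0.
Proof. by rewrite /trilin big1 // => a _; rewrite bil0l wedge0l. Qed.

Lemma trilin0m u e : trilin u 0 e = 0.
Proof. by rewrite /trilin big1 // => a _; rewrite bil0r wedge0l. Qed.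

(** The differentials of the arguments enter through equations, so that known values such as d sigma
    = 0 are substituted on application. *)
Lemma ext_trilin k k' m t u du v dv e de :
  spinor k u -> spinor k' v -> (forall a, pform m t (e a)) ->
  (fun i => ext (u i)) = du -> (fun i => ext (v i)) = dv -> (fun a => ext (e a)) = de ->
  ext (trilin u v e) = trilin du v e + (-1) ^+ k *: trilin u dv e
    + (-1) ^+ (k + k') *: trilin u v de.
Proof.
move=> pu pv pe <- <- <-; rewrite /trilin.
rewrite (ext_pform_sum _ (fun a => pform_wedge (pform_bil _ pu pv) (pe a))).
rewrite !scaler_sumr -!big_split; apply: eq_bigr => a _ /=.
rewrite (ext_wedge (pform_bil _ pu pv) (pe a)) (ext_bil _ pu pv).
by rewrite wedgeDl wedgeZl.
Qed.

Lemma ext_metric m t m' t' e de f df :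
  (forall a, pform m t (e a)) -> (forall a, pform m' t' (f a)) ->
  (fun a => ext (e a)) = de -> (fun a => ext (f a)) = df ->
  ext (metric e f) = metric de f + (-1) ^+ m *: metric e df.
Proof.
move=> pe pf <- <-; have pef a b := pformZ (eta R d a b) (pform_wedge (pe a) (pf b)).
rewrite /metric (ext_pform_sum _ (fun a => pform_sum _ (fun b _ => pef a b))).
rewrite scaler_sumr -big_split; apply: eq_bigr => a _ /=.
rewrite (ext_pform_sum _ (pef a)) scaler_sumr -big_split; apply: eq_bigr => b _ /=.
rewrite extZ; last exact: pform_derivable (pform_wedge (pe a) (pf b)).
by rewrite (ext_wedge (pe a) (pf b)) scalerDr !scalerA mulrC.
Qed.

Lemma spinor_th p : smooth_point p -> spinor 0 (pth p).
Proof. exact: point_th. Qed.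

Lemma spinor_sigmaL p : smooth_point p -> spinor 1 (sigmaL p).
Proof. exact: point_dth. Qed.

Lemma ext_sigmaL p : smooth_point p -> (fun al => ext (sigmaL p al)) = 0.
Proof. by move=> sp; apply/funext => al; exact: ext_ext (point_th sp al). Qed.

Lemma ext_bilU p q : smooth_point p -> smooth_point q ->
  (fun a => ext (bilU (pth p) (sigmaL q) a)) = bilU (sigmaL p) (sigmaL q).
Proof.
move=> sp sq; apply/funext => a.
rewrite [LHS](ext_bil _ (point_th sp) (point_dth sq)) -[RHS]addr0; congr (_ + _).
by rewrite [X in bil _ _ X](ext_sigmaL sq) bil0r scaler0.
Qed.

(** The Maurer-Cartan equation: d(dx) = 0, and d(theta Gamma sigma) = sigma Gamma sigma because
    sigma is closed. *)
Lemma ext_eL p : smooth_point p ->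
  (fun a => ext (eL p a)) = 2^-1 *: bilU (sigmaL p) (sigmaL p).
Proof.
move=> sp; rewrite -(ext_bilU sp sp); apply/funext => a.
have pb := pform_bilU Gam C (point_th sp) (point_dth sp) a.
rewrite eLE extD; [|exact: pform_derivable (point_dx sp a)|
  exact: pform_derivable (pformZ _ pb)].
by rewrite extZ; [rewrite (point_ddx sp) add0r|exact: pform_derivable pb].
Qed.

Lemma ext_eR p : smooth_point p ->
  (fun a => ext (eR p a)) = - 2^-1 *: bilU (sigmaL p) (sigmaL p).
Proof.
move=> sp; rewrite -(ext_bilU sp sp); apply/funext => a.
have pb := pform_bilU Gam C (point_th sp) (point_dth sp) a.
rewrite eRE -scaleNr extD; [|exact: pform_derivable (point_dx sp a)|
  exact: pform_derivable (pformZ _ pb)].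
by rewrite extZ; [rewrite (point_ddx sp) add0r|exact: pform_derivable pb].
Qed.

(** Together with [eR_eL] this eliminates dx and e_R, leaving e_L as the only even one-form in the
    final comparisons. *)
Lemma dpxE p : dpx p = eL p - 2^-1 *: bilU (pth p) (sigmaL p).
Proof. by rewrite eLE addrK. Qed.

Lemma eR_eL p : eR p = eL p - bilU (pth p) (sigmaL p).
Proof.
rewrite eRE eLE; apply/funext => a; apply/funext => m; apply/funext => y.
rewrite !fctE /GRing.scale /=; lra.
Qed.

(* In the suffixes t stands for a spinor of form degree 0 (theta) and s for one of
   form degree 1 (sigma). *)
Lemma trilin_symt u v e : spinor 0 u -> spinor 0 v -> trilin u v e = - trilin v u e.
Proof. by move=> pu pv; rewrite (trilin_sym hmaj e pu pv) expr1 scaleN1r. Qed.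

Lemma trilin_symts u v e : spinor 1 u -> spinor 0 v -> trilin u v e = - trilin v u e.
Proof. by move=> pu pv; rewrite (trilin_sym hmaj e pu pv) expr1 scaleN1r. Qed.

Lemma trilin_syms u v e : spinor 1 u -> spinor 1 v -> trilin u v e = trilin v u e.
Proof. by move=> pu pv; rewrite (trilin_sym hmaj e pu pv) expr2 mulrNN mulr1 scale1r. Qed.

Lemma bilU_symts u v : spinor 1 u -> spinor 0 v -> bilU u v = - bilU v u.
Proof. by move=> pu pv; rewrite (bilU_sym hmaj pu pv) expr1 scaleN1r. Qed.

Lemma bilU_syms u v : spinor 1 u -> spinor 1 v -> bilU u v = bilU v u.
Proof. by move=> pu pv; rewrite (bilU_sym hmaj pu pv) expr2 mulrNN mulr1 scale1r. Qed.

Lemma trilin_swap11 u v w z :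
  spinor 0 u -> spinor 1 v -> spinor 0 w -> spinor 1 z ->
  trilin u v (bilU w z) = - trilin w z (bilU u v).
Proof. by move=> pu pv pw pz; rewrite (trilinC Gam C pu pv pw pz) expr1 scaleN1r. Qed.

Lemma trilin_swap12 u v w z :
  spinor 1 u -> spinor 1 v -> spinor 0 w -> spinor 1 z ->
  trilin u v (bilU w z) = trilin w z (bilU u v).
Proof.
by move=> pu pv pw pz; rewrite (trilinC Gam C pu pv pw pz) expr2 mulrNN mulr1 scale1r.
Qed.

(** Spinor one-forms commute with each other, so all signs are plus. The first slot [u] stays in
    place and may be a theta or a sigma. *)
Lemma fierz_ssss u v w z : spinor 1 v -> spinor 1 w -> spinor 1 z ->
  trilin u v (bilU w z) + trilin u w (bilU z v) + trilin u z (bilU v w) = 0.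
Proof.
move=> pv pw pz; have := trilin_fierz hmaj hfierz u pv pw pz.
have -> : (-1) ^+ ((1 * 1).+1 + (1 * 1).+1) = 1 :> R by rewrite -signr_odd.
by rewrite !scale1r.
Qed.

(** Solved for the term pairing [u] with the degree-0 spinor [v], for use as a rewriting rule. *)
Lemma fierz_ttss u v w z : spinor 0 v -> spinor 1 w -> spinor 1 z ->
  trilin u v (bilU w z) = trilin u w (bilU v z) + trilin u z (bilU v w).
Proof.
move=> pv pw pz; have := trilin_fierz hmaj hfierz u pv pw pz.
have -> : (-1) ^+ ((0 * 1).+1 + (0 * 1).+1) = 1 :> R by rewrite -signr_odd.
have -> : (-1) ^+ ((1 * 1).+1 + (0 * 1).+1) = - 1 :> R by rewrite -signr_odd.
rewrite scale1r scaleN1r (bilU_symts pz pv) trilinNr => /eqP.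
by rewrite -addrA -opprD subr_eq0 => /eqP.
Qed.

(** The polarised identity is applied with the one-form [z] in the fixed first slot, so that the
    three thetas are permuted; moving [z] to the last slot then costs the same sign in every
    term. *)
Lemma fierz_ttts u v w z : spinor 0 u -> spinor 0 v -> spinor 0 w -> spinor 1 z ->
  trilin u v (bilU w z) + trilin v w (bilU u z) + trilin w u (bilU v z) = 0.
Proof.
move=> pu pv pw pz.
have swap x y t : spinor 0 x -> spinor 0 y -> spinor 0 t ->
    trilin z x (bilU y t) = - trilin y t (bilU x z).
  by move=> px py pt; rewrite trilin_symts // (trilinC Gam C px pz py pt) muln0 scale1r.
have := trilin_fierz hmaj hfierz z pu pv pw.
have -> : (-1) ^+ ((0 * 0).+1 + (0 * 0).+1) = 1 :> R by rewrite -signr_odd.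
rewrite !scale1r !swap // -!opprD => /eqP; rewrite oppr_eq0 => /eqP <-.
by rewrite -addrA addrC.
Qed.

Lemma dpx_mulT p q : smooth_point p -> smooth_point q ->
  dpx (mulT p q) = dpx p + dpx q
   + 2^-1 *: (bilU (pth q) (sigmaL p) - bilU (pth p) (sigmaL q)).
Proof.
move=> sp sq; have -> : dpx (mulT p q) = dpx p + dpx q
   - 2^-1 *: (bilU (sigmaL p) (pth q) + bilU (pth p) (sigmaL q)).
  by apply/funext => a; exact: dx_mulT.
rewrite (bilU_symts (spinor_sigmaL sp) (spinor_th sq)).
apply/funext => a; apply/funext => m; apply/funext => y; rewrite !fctE /GRing.scale /=.
lra.
Qed.

(** The mixed terms are 1/2 (theta_2 Gamma sigma_1 - theta_1 Gamma sigma_2) in dx and 1/2 (theta_2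
    Gamma sigma_1 + theta_1 Gamma sigma_2) in 1/2 theta Gamma sigma. Their sum gives the correction
    for e_L, their difference that for e_R. *)
Lemma eL_mulT p q : smooth_point p -> smooth_point q ->
  eL (mulT p q) = eL p + eL q + bilU (pth q) (sigmaL p).
Proof.
move=> sp sq; rewrite [eL _]eLE [eL p]eLE [eL q]eLE dpx_mulT // sigmaL_mulT //.
rewrite (_ : pth (mulT p q) = pth p + pth q) //.
move: (sigmaL p) (sigmaL q) (dpx p) (dpx q) => sp' sq' x y; rewrite !bilUDl !bilUDr.
apply/funext => a; apply/funext => m; apply/funext => t; rewrite !fctE /GRing.scale /=.
lra.
Qed.

Lemma eR_mulT p q : smooth_point p -> smooth_point q ->
  eR (mulT p q) = eR p + eR q - bilU (pth p) (sigmaL q).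
Proof.
move=> sp sq; rewrite [eR _]eRE [eR p]eRE [eR q]eRE dpx_mulT // sigmaL_mulT //.
rewrite (_ : pth (mulT p q) = pth p + pth q) //.
move: (sigmaL p) (sigmaL q) (dpx p) (dpx q) => sp' sq' x y; rewrite !bilUDl !bilUDr.
apply/funext => a; apply/funext => m; apply/funext => t; rewrite !fctE /GRing.scale /=.
lra.
Qed.

Lemma ext_Hpt p : smooth_point p -> ext (Hpt p) = 0.
Proof.
move=> sp; have ps := spinor_sigmaL sp.
rewrite /Hpt (ext_trilin ps ps (fun a => pform_eL Gam C a sp) (ext_sigmaL sp)
  (ext_sigmaL sp) (ext_eL sp)).
rewrite trilin0l trilin0m scaler0 !add0r trilinZr.
(* With four equal spinors the Fierz identity says that three times the remaining term is zero. *)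
have := fierz_ssss (sigmaL p) ps ps ps.
rewrite -mulr2n -mulrSr -scaler_nat => /eqP; rewrite scaler_eq0 pnatr_eq0 /= => /eqP ->.
by rewrite !scaler0.
Qed.


Lemma ext_rho_pt p q : smooth_point p -> smooth_point q ->
  ext (rho_pt p q) =
    - 2 *: (2^-1 *: trilin (sigmaL p) (sigmaL p) (eR q)
            + 2^-1 *: trilin (sigmaL q) (sigmaL q) (eL p))
    - 2 *: (trilin (sigmaL q) (sigmaL p)
              (eL p + dpx q - 6^-1 *: bilU (pth q) (sigmaL q))
            - trilin (pth q) (sigmaL p)
                (2^-1 *: bilU (sigmaL p) (sigmaL p) - 6^-1 *: bilU (sigmaL q) (sigmaL q))).
Proof.
move=> sp sq; have [pL pR] := (fun a => pform_eL Gam C a sp, fun a => pform_eR Gam C a sq).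
have pa a := pform_rho_arg Gam C a sp sq.
have pm := pform_metric pL pR.
have pt := pform_trilin Gam C (spinor_th sq) (spinor_sigmaL sp) pa.
have ea : (fun a => ext ((eL p + dpx q - 6^-1 *: bilU (pth q) (sigmaL q)) a)) =
    2^-1 *: bilU (sigmaL p) (sigmaL p) - 6^-1 *: bilU (sigmaL q) (sigmaL q).
  rewrite -(ext_eL sp) -(ext_bilU sq sq); apply/funext => a.
  have pb := pform_bilU Gam C (point_th sq) (point_dth sq) a.
  have px := point_dx sq a.
  transitivity (ext (eL p a + dpx q a + - 6^-1 *: bilU (pth q) (sigmaL q) a)).
    by rewrite scaleNr.
  rewrite extD; [|exact: pform_derivable (pformD (pL a) px)
    |exact: pform_derivable (pformZ _ pb)].
  rewrite extD; [|exact: pform_derivable (pL a)|exact: pform_derivable px].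
  rewrite extZ; last exact: pform_derivable pb.
  by rewrite (point_ddx sq) addr0 scaleNr.
rewrite /rho_pt -[- (2 *: trilin _ _ _)]scaleNr extD;
  [|exact: pform_derivable (pformZ _ pm)|exact: pform_derivable (pformZ _ pt)].
rewrite extZ; last exact: pform_derivable pm.
rewrite extZ; last exact: pform_derivable pt.
(* The sign from passing d over the one-form e_L(p) cancels the minus in de_R = -1/2 sigma Gamma
   sigma. *)
rewrite (ext_metric pL pR (ext_eL sp) (ext_eR sq)).
rewrite (ext_trilin (spinor_th sq) (spinor_sigmaL sp) pa erefl (ext_sigmaL sp) ea).
rewrite trilin0m scaler0 addr0 metricZl metric_bilUl metricZr.
rewrite (metric_bilUr Gam C pL (spinor_sigmaL sq) (spinor_sigmaL sq)).
rewrite expr1 scaleN1r expr2 mulrNN mulr1 scale1r scaleN1r !scaleNr opprK.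
by [].
Qed.

Lemma ext_theta_pt p q r : smooth_point p -> smooth_point q -> smooth_point r ->
  let E := 3 *: eL p + 2 *: bilU (pth q) (sigmaL p) + bilU (pth r) (sigmaL p) in
  ext (theta_pt p q r) = - (2 / 3) *:
    (trilin (sigmaL q) (pth r) E + trilin (pth q) (sigmaL r) E
     + trilin (pth q) (pth r) (3 *: (2^-1 *: bilU (sigmaL p) (sigmaL p))
         + 2 *: bilU (sigmaL q) (sigmaL p) + bilU (sigmaL r) (sigmaL p))).
Proof.
move=> sp sq sr E; have pa a := pform_theta_arg Gam C a sp sq sr.
have pt := pform_trilin Gam C (spinor_th sq) (spinor_th sr) pa.
have ea : (fun a => ext (E a)) = 3 *: (2^-1 *: bilU (sigmaL p) (sigmaL p))
         + 2 *: bilU (sigmaL q) (sigmaL p) + bilU (sigmaL r) (sigmaL p).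
  rewrite -(ext_eL sp) -(ext_bilU sq sp) -(ext_bilU sr sp); apply/funext => a.
  have p1 := pform_eL Gam C a sp.
  have p2 := pform_bilU Gam C (point_th sq) (point_dth sp) a.
  have p3 := pform_bilU Gam C (point_th sr) (point_dth sp) a.
  transitivity (ext (3 *: eL p a + 2 *: bilU (pth q) (sigmaL p) a
    + bilU (pth r) (sigmaL p) a)); first by [].
  rewrite extD; [|exact: pform_derivable (pformD (pformZ _ p1) (pformZ _ p2))
    |exact: pform_derivable p3].
  rewrite extD; [|exact: pform_derivable (pformZ _ p1)
    |exact: pform_derivable (pformZ _ p2)].
  rewrite extZ; last exact: pform_derivable p1.
  by rewrite extZ; last exact: pform_derivable p2.
rewrite /theta_pt extZ; last exact: pform_derivable pt.
rewrite (ext_trilin (spinor_th sq) (spinor_th sr) pa erefl erefl ea).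
by rewrite !expr0 !scale1r.
Qed.

End Forms.
End InvariantForms.

(** * Coboundaries at arbitrary points *)

Section Coboundaries.
Variables (R : realType) (d D : nat).
Variables (Gam : 'I_d.+1 -> 'M[R]_D) (C : 'M[R]_D).
Hypotheses (hmaj : majorana Gam C) (hfierz : fierz Gam C).
Notation trilin := (trilin Gam C).
Notation bilU := (bilU Gam C).
Notation eL := (eL Gam C).
Notation eR := (eR Gam C).
Notation mulT := (mulT Gam C).
Notation Hpt := (Hpt Gam C).
Notation rho_pt := (rho_pt Gam C).
Notation theta_pt := (theta_pt Gam C).
Variable (n : nat).
Implicit Types (u v w z th sg s t : 'I_D -> sform R d D n) (e f : 'I_d.+1 -> sform R d D n).
Implicit Types (p q r : gpoint R d D n).

Lemma Hpt_coboundary p q : smooth_point p -> smooth_point q ->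
  Hpt q - Hpt (mulT p q) + Hpt p = ext (rho_pt p q).
Proof.
move=> sp sq; rewrite (ext_rho_pt Gam C sp sq) /Hpt (eL_mulT hmaj sp sq) sigmaL_mulT //.
rewrite (dpxE Gam C) eR_eL.
move: (spinor_sigmaL sp) (spinor_sigmaL sq) (spinor_th sq).
move: (sigmaL p) (sigmaL q) (pth q) (eL p) (eL q) => s1 s2 t2 e1 e2 p1 p2 pt.
(* The e-terms cancel by symmetry. What is left contains theta_2 and three sigmas, at least one of
   them sigma_1, so one Fierz identity is needed for each number of sigma_2. The constant 1/6 makes
   the terms with sigma_1, sigma_2, sigma_2 proportional to the combination in [h122]. *)
have h111 := fierz_ssss hmaj hfierz t2 p1 p1 p1.
have h112 := fierz_ssss hmaj hfierz t2 p1 p1 p2.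
have h122 := fierz_ssss hmaj hfierz t2 p1 p2 p2.
rewrite !(trilinDl, trilinDm, trilinDr, trilinZr, trilinNr).
rewrite !(trilin_syms hmaj _ p2 p1).
have sw u v w : spinor 1 u -> spinor 1 v -> spinor 1 w ->
  trilin u v (bilU t2 w) = trilin t2 w (bilU u v).
  by move=> pu pv pw; exact: (trilin_swap12 Gam C pu pv pt pw).
rewrite !sw //.
rewrite (bilU_syms hmaj p2 p1) in h112 h122 *.
apply/funext => m; apply/funext => y.
have at0 (x : sform R d D n) : x = 0 -> x m y = 0 by move->.
move: (at0 _ h111) (at0 _ h112) (at0 _ h122).
rewrite !fctE /GRing.scale /=.
lra.
Qed.

Lemma theta_pt_closed p q r l :
  smooth_point p -> smooth_point q -> smooth_point r -> smooth_point l ->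
  theta_pt q r l - theta_pt (mulT p q) r l + theta_pt p (mulT q r) l
  - theta_pt p q (mulT r l) + theta_pt p q r = 0.
Proof.
move=> sp sq sr sl; rewrite /theta_pt (eL_mulT hmaj sp sq) sigmaL_mulT //.
rewrite (_ : pth (mulT q r) = pth q + pth r) // (_ : pth (mulT r l) = pth r + pth l) //.
move: (spinor_sigmaL sp) (spinor_sigmaL sq) (spinor_th sq) (spinor_th sr) (spinor_th sl).
move: (sigmaL p) (sigmaL q) (pth q) (pth r) (pth l) (eL p) (eL q).
move=> s1 s2 t2 t3 t4 e1 e2 p1 p2 pt2 pt3 pt4.
(* The e-terms and all terms with sigma_2 cancel by multilinearity. The rest is a multiple of this
   single instance, in which theta_2, theta_3, theta_4 and sigma_1 each occur once per term. *)
have h := fierz_ttts hmaj hfierz pt2 pt3 pt4 p1.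
rewrite (trilin_symt hmaj _ pt4 pt2) in h.
rewrite !(bilUDl, bilUDr) !(trilinDl, trilinDm, trilinDr, trilinZr, trilinNr).
apply/funext => m; apply/funext => y.
have at0 (x : sform R d D n) : x = 0 -> x m y = 0 by move->.
rewrite [RHS](at0 _ erefl); move: (at0 _ h).
rewrite !fctE /GRing.scale /=.
lra.
Qed.

Lemma rho_pt_coboundary p q r : smooth_point p -> smooth_point q -> smooth_point r ->
  rho_pt q r - rho_pt (mulT p q) r + rho_pt p (mulT q r) - rho_pt p q
  = ext (theta_pt p q r).
Proof.
move=> sp sq sr; rewrite (ext_theta_pt Gam C sp sq sr) /rho_pt.
rewrite (eL_mulT hmaj sp sq) (eR_mulT hmaj sq sr) (dpx_mulT hmaj sq sr) !sigmaL_mulT //.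
rewrite (_ : pth (mulT q r) = pth q + pth r) // !(dpxE Gam C) !eR_eL.
move: (fun a => pform_eL Gam C a sp) (fun a => pform_eL Gam C a sq).
move: (spinor_sigmaL sp) (spinor_sigmaL sq) (spinor_sigmaL sr) (spinor_th sq) (spinor_th sr).
move: (sigmaL p) (sigmaL q) (sigmaL r) (pth q) (pth r) (eL p) (eL q) (eL r).
move=> s1 s2 s3 t2 t3 e1 e2 e3 ps1 ps2 ps3 pt2 pt3 pe1 pe2.
have mE e u v : (forall a, pform 1 false (e a)) -> spinor 0 u -> spinor 1 v ->
    metric e (bilU u v) = - trilin u v e.
  by move=> pe pu pv; rewrite (metric_bilUr Gam C pe pu pv) expr1 scaleN1r.
rewrite !(bilUDl, bilUDr) !(trilinDl, trilinDm, trilinDr, trilinZr, trilinNr).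
rewrite !(metricDl, metricDr, metricNr, metric_bilUl) !mE //.
(* The Fierz identity serves here as a normalisation: every (theta Gamma theta)(sigma Gamma sigma)
   becomes a difference of products (theta Gamma sigma)(theta Gamma sigma), among which only the
   exchange of the two factors is used. *)
have ttss u v w z : spinor 0 u -> spinor 0 v -> spinor 1 w -> spinor 1 z ->
    trilin u v (bilU w z) = trilin u w (bilU v z) - trilin v w (bilU u z).
  move=> pu pv pw pz; rewrite (fierz_ttss hmaj hfierz _ pv pw pz).
  by rewrite (trilin_swap11 _ _ pu pz pv pw).
rewrite !(trilin_symts hmaj _ ps2 pt3) !(ttss t2 t3) //.
(* The antisymmetric exchange of the two factors fixes an order: theta_2 before theta_3, and for a
   repeated theta the factor with sigma_1 first. *)
have sw x y : spinor 1 x -> spinor 1 y ->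
    trilin t3 x (bilU t2 y) = - trilin t2 y (bilU t3 x).
  by move=> px py; exact: (trilin_swap11 Gam C pt3 px pt2 py).
rewrite !sw // (trilin_swap11 Gam C pt2 ps3 pt2 ps1) (trilin_swap11 Gam C pt3 ps2 pt3 ps1).
apply/funext => m; apply/funext => y.
rewrite !fctE /GRing.scale /=.
lra.
Qed.


End Coboundaries.

(** * The simplicial differential on the nerve *)

Section Nerve.
Variables (R : realType) (d D : nat).
Variables (Gam : 'I_d.+1 -> 'M[R]_D) (C : 'M[R]_D).
Hypotheses (hmaj : majorana Gam C) (hfierz : fierz Gam C).
Notation Delta := (Delta Gam C).

Lemma Delta0 n : Delta (0 : sform R d D n) = 0.
Proof.
rewrite /Delta big1 // => i _.
by rewrite (pull0 (pull_gen_supported (@smooth_face _ _ _ Gam C n i))) scaler0.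
Qed.

Definition face_pt n i j : gpoint R d D n.+2 :=
  let P l := coord_pt R d D (inord l : 'I_n.+2) in
  if (j.+1 < i)%N then P j else if j.+1 == i then mulT Gam C (P j) (P j.+1) else P j.+1.

(** The summand is indexed by natural numbers, so that the alternating sum unfolds into explicit
    terms on which [face_pt] computes. *)
Lemma DeltaE n (w : sform R d D n.+1) (F : nat -> sform R d D n.+2) :
  (forall i : 'I_n.+3, pull (face Gam C i) w = F i) ->
  Delta w = \sum_(0 <= i < n.+3) (-1) ^+ i *: F i.
Proof. by move=> pF; rewrite big_mkord; apply: eq_bigr => i _; rewrite pF. Qed.

Lemma alternating3 (V : lmodType R) (F : nat -> V) :
  \sum_(0 <= i < 3) (-1) ^+ i *: F i = F 0%N - F 1%N + F 2%N.
Proof.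
rewrite !big_nat_recr //= big_geq // add0r scale1r expr1 scaleN1r.
by rewrite -(signr_odd _ 2) scale1r.
Qed.

Lemma alternating4 (V : lmodType R) (F : nat -> V) :
  \sum_(0 <= i < 4) (-1) ^+ i *: F i = F 0%N - F 1%N + F 2%N - F 3%N.
Proof.
by rewrite big_nat_recr //= alternating3 -(signr_odd _ 3) expr1 scaleN1r.
Qed.

Lemma alternating5 (V : lmodType R) (F : nat -> V) :
  \sum_(0 <= i < 5) (-1) ^+ i *: F i = F 0%N - F 1%N + F 2%N - F 3%N + F 4%N.
Proof.
by rewrite big_nat_recr //= alternating4 -(signr_odd _ 4) scale1r.
Qed.

Lemma Delta_H_GS : Delta (H_GS Gam C) = ext (rho_GS Gam C).
Proof.
rewrite H_GSE rho_GSE (DeltaE (F := fun i => Hpt Gam C (face_pt 0 i 0))); last first.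
  by move=> i; rewrite pull_Hpt ?face_inord //; exact: smooth_face.
rewrite alternating3 /face_pt /=.
by apply: (Hpt_coboundary hmaj hfierz); exact: smooth_coord.
Qed.

Lemma Delta_rho_GS : Delta (rho_GS Gam C) = ext (theta_GS Gam C).
Proof.
rewrite rho_GSE theta_GSE.
rewrite (DeltaE (F := fun i => rho_pt Gam C (face_pt 1 i 0) (face_pt 1 i 1))); last first.
  by move=> i; rewrite pull_rho_pt ?face_inord //; exact: smooth_face.
rewrite alternating4 /face_pt /=.
by apply: (rho_pt_coboundary hmaj hfierz); exact: smooth_coord.
Qed.

Lemma Delta_theta_GS : Delta (theta_GS Gam C) = 0.
Proof.
rewrite theta_GSE (DeltaE (F := fun i =>
  theta_pt Gam C (face_pt 2 i 0) (face_pt 2 i 1) (face_pt 2 i 2))); last first.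
  by move=> i; rewrite pull_theta_pt ?face_inord //; exact: smooth_face.
rewrite alternating5 /face_pt /=.
by apply: (theta_pt_closed hmaj hfierz); exact: smooth_coord.
Qed.

Lemma ext_H_GS : ext (H_GS Gam C) = 0.
Proof. by rewrite H_GSE (ext_Hpt hmaj hfierz (smooth_coord _ _ _ _)). Qed.

End Nerve.

Theorem proposition46 (R : realType) (d D : nat)
    (Gam : 'I_d.+1 -> 'M[R]_D) (C : 'M[R]_D)
    (hmaj : majorana Gam C) (hfierz : fierz Gam C) :
  deRham_4cocycle Gam C 0 (H_GS Gam C) (rho_GS Gam C) (theta_GS Gam C) 0 /\
  [/\ ext (H_GS Gam C) = 0,
      Delta Gam C (H_GS Gam C) = ext (rho_GS Gam C),
      Delta Gam C (rho_GS Gam C) = ext (theta_GS Gam C)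
    & Delta Gam C (theta_GS Gam C) = 0].
Proof.
have dH := ext_H_GS hmaj hfierz; have DH := Delta_H_GS hmaj hfierz.
have Drho := Delta_rho_GS hmaj hfierz; have Dtheta := Delta_theta_GS hmaj hfierz.
split=> //; split; split.
- exact: superform_pform (@pform0 _ _ _ _ 4 false).
- by rewrite H_GSE; apply: superform_pform (pform_Hpt Gam C (smooth_coord _ _ _ _)).
- rewrite rho_GSE.
  by apply: superform_pform (pform_rho_pt Gam C (smooth_coord _ _ _ _) (smooth_coord _ _ _ _)).
- rewrite theta_GSE; apply: superform_pform
    (pform_theta_pt Gam C (smooth_coord _ _ _ _) (smooth_coord _ _ _ _)
      (smooth_coord _ _ _ _)).
- exact: superform_pform (@pform0 _ _ _ _ 0 false).
- exact: ext0.
(* With zero outer components the two end conditions become dH = 0 and the vanishing of Delta on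
   [theta_GS]. *)
- by split; rewrite ?Delta0 ?ext0.
Qed.
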